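(* Let $(N_t)_{t\ge0}$ be a branching process on $\mathbb N_0^*$ whose probability generating functions $(F_{s,t})_{(s,t)\in\Delta}$ form an absolutely continuous reverse evolution family in $\mathbb D$ with associated Herglotz vector field $\Phi(z,t)=q_tz+\sum_{n\in\mathbb N_0\setminus\{1\}}\alpha_t(n)(z-z^n)$, $(q_t,\alpha_t)$ a generating family. The following are equivalent: (1) $\mathbb E^{(s,n)}[N_t]<\infty$ for all $n\in\mathbb N$ and $(s,t)\in\Delta$; (2) $\mathbb E^{(0,1)}[N_t]<\infty$ for all $t\ge0$; (3) $F_{0,t}(1)=1$ and $F'_{0,t}(1)<\infty$ for all $t\ge0$; (4) $F_{s,t}(1)=1$ and $F'_{s,t}(1)<\infty$ for all $(s,t)\in\Delta$; (5) $\Phi(1,t)=0$ for a.e. $t\ge0$ and $t\mapsto\Phi'(1,t)$ is in $L^1_{\rm loc}$; (6) $q_t=0$ for a.e. $t\ge0$ and $t\mapsto\sum_{n\in\mathbb N_0\setminus\{1\}}(n+1)\alpha_t(n)$ is in $L^1_{\rm loc}$. If these hold, then $\mathbb E^{(s,n)}[N_t]=nF'_{s,t}(1)=n\exp\big(-\int_s^t\Phi'(1,r)\,\mathrm dr\big)$ for all $n\in\mathbb N$ and $(s,t)\in\Delta$.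
   Context: $\Delta=\{(s,t):0\le s\le t\}$, $\mathbb D=\{|z|<1\}$, $\mathbb N_0^*=\{0,1,2,\dots\}\cup\{\infty\}$; $L^1_{\rm loc}$: integrable on compact subintervals. A branching process on $\mathbb N_0^*$ is a Markov family $(N_t)$ (probabilities $\mathbb P^{(s,n)}$ with $\mathbb P^{(s,n)}[N_s=n]=1$ and Markov property $\mathbb E^{(s,n)}[f(N_u)|\mathcal F_{[s,t]}]=\int f(y)\ell_{t,u}(N_t,\mathrm dy)$) with transition kernels $(\ell_{s,t})$ on $\mathbb N_0^*$ satisfying $\ell_{s,s}(n,\cdot)=\delta_n$, $\ell_{s,t}\star\ell_{t,u}=\ell_{s,u}$, weak continuity of $(s,t)\mapsto\ell_{s,t}(n,\cdot)$ for $n\in\mathbb N_0$, $\ell_{s,t}(m,\cdot)\ast\ell_{s,t}(n,\cdot)=\ell_{s,t}(m+n,\cdot)$, $\ell_{s,t}(0,\cdot)=\delta_0$, $\ell_{s,t}(\infty,\cdot)=\delta_\infty$. Its probability generating functions: $F_{s,t}(z)=\sum_{n\ge0}\ell_{s,t}(1,\{n\})z^n$. Absolutely continuous reverse evolution family: $F_{s,s}={\rm id}$, $F_{s,u}=F_{s,t}\circ F_{t,u}$, $|F_{s,u}(z)-F_{s,t}(z)|\le\int_t^u f_z$ with $f_z\in L^1_{\rm loc}$; its associated Herglotz vector field $\Phi$ is the a.e.-unique function with $\frac{\mathrm d}{\mathrm ds}F_{s,t}(z)=\Phi(F_{s,t}(z),s)$ a.e. on $[0,t]$, and it has the stated form with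 $q_t\ge0$, $\alpha_t(n)\ge0$, $t\mapsto\alpha_t(n)$ measurable, $t\mapsto q_t$ and $t\mapsto\sum_n\alpha_t(n)$ in $L^1_{\rm loc}$. Notation: $F^{(n)}(1):=\lim_{\mathbb R\ni x\to1^-}F^{(n)}(x)$, $\Phi^{(n)}(1,t):=\lim_{\mathbb R\ni x\to1^-}\Phi^{(n)}(x,t)$ (spatial derivatives). *)

(* Defs.v *)
From HB Require Import structures.
From mathcomp Require Import all_boot all_order all_algebra.
From mathcomp Require Import all_classical all_reals all_analysis.
From mathcomp.real_closed Require Export complex.
Set Implicit Arguments.
Unset Strict Implicit.
Unset Printing Implicit Defensive.
Import Order.TTheory GRing.Theory Num.Theory.
Import numFieldNormedType.Exports.
Local Open Scope classical_set_scope.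
Local Open Scope ring_scope.

(* The state space N_0^* = {0,1,2,...} \cup {oo}: [Some k] is k, [None] is oo. *)
Definition N0s := option nat.

Definition addN0s (m n : N0s) : N0s :=
  match m, n with Some a, Some b => Some (a + b)%N | _, _ => None end.

Definition extN0s {R : realType} (m : N0s) : \bar R :=
  match m with Some k => (k%:R)%:E | None => +oo%E end.

Section Defs.
Variable R : realType.

(* Measures on N_0^* are given by their mass functions mu : N0s -> R.  *)

Definition is_prob (mu : N0s -> R) : Prop :=
  (forall k, 0 <= mu k) /\
  ((mu None)%:E + \sum_(k <oo) (mu (Some k))%:E = 1%:E)%E.

Definition mass_fin (mu : N0s -> R) : R := limn (series (fun k => mu (Some k))).
Definition mass (mu : N0s -> R) : R := mu None + mass_fin mu.

Definition kint (mu : N0s -> R) (f : N0s -> R) : R :=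
  mu None * f None + limn (series (fun k => mu (Some k) * f (Some k))).

(* convolution of measures on N_0^*: image of mu (x) nu under addN0s *)
Definition conv (mu nu : N0s -> R) : N0s -> R := fun k =>
  match k with
  | Some k => \sum_(i < k.+1) mu (Some (i : nat)) * nu (Some (k - i)%N)
  | None => mu None * mass nu + mass_fin mu * nu None
  end.

Definition dirac_N0s (m : N0s) : N0s -> R := fun k => (k == m)%:R.

(* continuous functions on N_0^* (one-point compactification of N_0) *)
Definition cont_N0s (f : N0s -> R) : Prop :=
  (fun k => f (Some k)) @ \oo --> f None.

Definition DeltaSet : set (R * R) := [set st | 0 <= st.1 <= st.2].

(* transition kernels (ell_{s,t})_{(s,t) in Delta}: ell s t m k = ell_{s,t}(m,{k}) *)
Definition branching_kernels (ell : R -> R -> N0s -> N0s -> R) : Prop :=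
  [/\ (forall s t m, 0 <= s <= t -> is_prob (ell s t m)),
      (forall s m, 0 <= s -> ell s s m =1 dirac_N0s m),
      (forall s t u m k, 0 <= s <= t -> t <= u ->
         ((ell s t m None * ell t u None k)%:E
          + \sum_(j <oo) (ell s t m (Some j) * ell t u (Some j) k)%:E
          = (ell s u m k)%:E)%E),
      (forall (n : nat) (f : N0s -> R), cont_N0s f ->
         {within DeltaSet, continuous (fun st => kint (ell st.1 st.2 (Some n)) f)}) &
      (forall s t, 0 <= s <= t ->
         [/\ (forall m n, ell s t (addN0s m n) =1 conv (ell s t m) (ell s t n)),
             ell s t (Some 0%N) =1 dirac_N0s (Some 0%N) &
             ell s t None =1 dirac_N0s None])].

Definition nat_filtration d (Omega : measurableType d) (N : R -> Omega -> N0s)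
  (s t : R) : set (set Omega) :=
  <<s [set A | exists r, r \in `[s, t] /\ exists B : set N0s, A = N r @^-1` B] >>.

Definition branching_process d (Omega : measurableType d)
  (P : R -> N0s -> probability Omega R) (N : R -> Omega -> N0s)
  (ell : R -> R -> N0s -> N0s -> R) : Prop :=
  [/\ branching_kernels ell,
      (forall t k, 0 <= t -> measurable (N t @^-1` [set k])),
      (forall s n, 0 <= s -> P s n (N s @^-1` [set n]) = 1%:E) &
      (* Markov property:
         E^{(s,n)}[f(N_u) | F_[s,t]] = int f(y) ell_{t,u}(N_t, dy) *)
      (forall s t u n (A : set Omega) (f : N0s -> R),
         0 <= s <= t -> t <= u -> (exists M, forall x, `|f x| <= M) ->
         nat_filtration N s t A ->
         (\int[P s n]_(w in A) (f (N u w))%:E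
          = \int[P s n]_(w in A) (kint (ell t u (N t w)) f)%:E)%E)].

Definition expect d (Omega : measurableType d)
  (P : R -> N0s -> probability Omega R) (N : R -> Omega -> N0s)
  (s : R) (n : N0s) (t : R) : \bar R :=
  (\int[P s n]_w extN0s (N t w))%E.

Local Open Scope complex_scope.

Definition cmod (z : R[i]) : R := Num.sqrt (complex.Re z ^+ 2 + complex.Im z ^+ 2).
Definition inD (z : R[i]) : Prop := cmod z < 1.

Definition cseries (a : nat -> R) (w : nat -> R[i]) : R[i] :=
  limn (series (fun n => a n * complex.Re (w n)))
  +i* limn (series (fun n => a n * complex.Im (w n))).

Definition pgf (p : N0s -> R) (z : R[i]) : R[i] :=
  cseries (fun n => p (Some n)) (fun n => z ^+ n).

Definition pgfs (ell : R -> R -> N0s -> N0s -> R) (s t : R) : R[i] -> R[i] :=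
  pgf (ell s t (Some 1%N)).

Definition on_reals (g : R[i] -> R[i]) (x : R) : R := complex.Re (g x%:C).

(* value at 1: g(1) := lim_{x -> 1^-} g(x) (in the extended reals) *)
Definition at1 (g : R -> R) : \bar R := lim ((g x)%:E @[x --> 1^'-]).

Definition L1loc (f : R -> \bar R) : Prop :=
  forall T, 0 <= T -> (@lebesgue_measure R).-integrable `[0, T] f.

Definition abs_cont_rev_evol_family (F : R -> R -> R[i] -> R[i]) : Prop :=
  [/\ (forall s t z, 0 <= s <= t -> inD z -> inD (F s t z)),
      (forall s z, 0 <= s -> inD z -> F s s z = z),
      (forall s t u z, 0 <= s <= t -> t <= u -> inD z ->
         F s u z = F s t (F t u z)) &
      (forall z, inD z -> exists fz : R -> R, L1loc (fun x => (fz x)%:E) /\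
         forall s t u, 0 <= s <= t -> t <= u ->
           ((cmod (F s u z - F s t z))%:E
            <= \int[@lebesgue_measure R]_(x in `[t, u]) (fz x)%:E)%E)].

(* generating family (q_t, alpha_t); alpha t n for n <> 1 (n = 1 ignored) *)
Definition generating_family (q : R -> R) (alpha : R -> nat -> R) : Prop :=
  [/\ (forall t, 0 <= t -> 0 <= q t),
      (forall t n, 0 <= t -> 0 <= alpha t n),
      (forall n, measurable_fun [set t : R | 0 <= t] (fun t => alpha t n)),
      L1loc (fun t => (q t)%:E) &
      L1loc (fun t => (\sum_(n <oo | n != 1%N) (alpha t n)%:E)%E)].

Definition herglotz (q : R -> R) (alpha : R -> nat -> R) (z : R[i]) (t : R) : R[i] :=
  (q t)%:C * z
  + cseries (fun n => if n == 1%N then 0 else alpha t n) (fun n => z - z ^+ n).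

Definition associated_vector_field (F : R -> R -> R[i] -> R[i])
  (Phi : R[i] -> R -> R[i]) : Prop :=
  forall t z, 0 <= t -> inD z ->
    {ae @lebesgue_measure R, forall s, s \in `[0, t] ->
      [/\ derivable (fun r => complex.Re (F r t z)) s 1,
          derivable (fun r => complex.Im (F r t z)) s 1,
          derive1 (fun r => complex.Re (F r t z)) s = complex.Re (Phi (F s t z) s) &
          derive1 (fun r => complex.Im (F r t z)) s = complex.Im (Phi (F s t z) s)]}.

End Defs.

(* Main.v *)
(**
The proof rests on one identity. For real x in [0, 1), write F_{s,t} for the
generating functions and Phi for the vector field. Then Phi(y, r) / (1 - y) =
J(r, y) - alpha_r(0), where
  J(r, y) = q_r y / (1 - y) + sum_k alpha_r(k) (y + ... + y^(k-1))
is nonnegative and nondecreasing in y. Since r |-> F_{r,t}(x) solves the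
evolution equation, r |-> ln (1 - F_{r,t}(x)) has derivative
alpha_r(0) - J(r, F_{r,t}(x)) almost everywhere, and it is absolutely
continuous: a generating function moves every point of [0, 1) by at most
1 - p_1, which is controlled by its displacement at the two points 0 and 1/2.
Hence
  ln ((1 - F_{s,t}(x)) / (1 - x)) = int_s^t (J(r, F_{r,t}(x)) - alpha_r(0)) dr.
As x increases to 1 the left-hand side tends to the logarithm of the mean of
the process started from one individual at time s, and the right-hand side is
governed by monotone convergence. If there is no explosion, F_{r,t}(x) tends to
1 and the integrand to (+oo) q_r + sum_k (k - 1)^+ alpha_r(k) - alpha_r(0), so
finite means force q = 0 and integrability of the rates; conversely J is
bounded by its limit.
*)
Require Import Defs.
From HB Require Import structures.
From mathcomp Require Import all_boot all_order all_algebra.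
From mathcomp Require Import all_classical all_reals all_analysis.
From mathcomp.real_closed Require Import complex.
From mathcomp Require Import measurable_realfun.
From mathcomp Require Import ring lra zify.
Set Implicit Arguments.
Unset Strict Implicit.
Unset Printing Implicit Defensive.
Import Order.TTheory GRing.Theory Num.Theory.
Import numFieldNormedType.Exports.
Local Open Scope classical_set_scope.
Local Open Scope ring_scope.

(** * A fundamental theorem of calculus for absolutely continuous functions *)

Section absolutely_continuous_ftc.
Context {R : realType}.
Local Notation mu := (@lebesgue_measure R).
Implicit Types (f g h H : R -> R) (a b : R).

(** The assumed bound concerns increments of F_{s,t}(z) in the second time, with a majorant f_z
    depending on z, whereas the evolution equation differentiates in the first time. Since
    F_{u,t}(x) = F_{u,v}(F_{v,t}(x)), an increment in the first time is the displacement of F_{u,v}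
    at a point that moves with v, so a majorant uniform in the point is required; the bound through
    the coefficient p_1 supplies it. The equation holds only off a null set depending on t and x,
    which is why the calculus is done for functions whose increments are dominated by an integral.
    The quotient that defines J serves twice. With the mass at oo in place of q and the
    probabilities p_k in place of the rates, J(y) + 1 - p_0 is the secant slope (1 - F(y)) / (1 -
    y), so one monotonicity statement and one limit at 1 cover both the vector field and the
    means. *)

Lemma continuous_primitive H a x : continuous H -> a < x ->
  is_derive x 1 (fun y => \int[mu]_(t in `[a, y]) H t) (H x).
Proof.
move=> cH ax.
have iH : mu.-integrable `[a, x + 1] (EFin \o H).
  apply: continuous_compact_integrable; first exact: segment_compact.
  exact: continuous_subspaceT.
have xx1 : x < x + 1 by rewrite ltrDl.
have [dF F'] := continuous_FTC1_closed xx1 iH ax (cH x).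
by apply: DeriveDef => //; rewrite -derive1E.
Qed.

Lemma continuous_increment H (c e : R) : continuous H ->
  continuous (fun x => c * (H (x + e) - H x)).
Proof.
move=> cH x.
apply: cvgM; first exact: cvg_cst.
apply: cvgB; last exact: cH.
apply: (@continuous_comp _ _ _ (fun y => y + e) H); last exact: cH.
by apply: cvgD; [exact: cvg_id|exact: cvg_cst].
Qed.

(** The integral telescopes to the average of H over [b, b + e] minus that over [a, a + e]. The
    first is H b because H is constant beyond b, the second is at least H a by monotonicity. *)
Lemma integral_increment_le H a b e : 0 < e -> a < b -> continuous H ->
  {homo H : x y / x <= y} -> (forall x, b <= x -> H x = H b) ->
  (\int[mu]_(x in `[a, b]) (e^-1 * (H (x + e) - H x))%:E <= (H b - H a)%:E)%E.
Proof.
move=> e0 ab cH ndH Hb.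
(* Starting the primitive at a - 1 makes it differentiable at a itself. *)
pose W y := \int[mu]_(t in `[a - 1, y]) H t.
have dW x : a - 1 < x -> is_derive x 1 W (H x).
  by move=> ?; exact: continuous_primitive.
have cW (x y : R) : a <= x -> {within `[x, y], continuous W}.
  move=> ax; apply: derivable_within_continuous => z; rewrite in_itv/= => /andP[xz _].
  by have [] : is_derive z 1 W (H z) by apply: dW; lra.
pose V y := e^-1 * (W (y + e) - W y).
have dV x : a - 1 < x -> is_derive x 1 V (e^-1 * (H (x + e) - H x)).
  move=> ax.
  have d1 : is_derive (x + e) 1 W (H (x + e)) by apply: dW; lra.
  have d2 : is_derive x 1 W (H x) by apply: dW.
  have d3 : is_derive x 1 (fun y : R => y + e) (1 + 0) by apply: is_deriveD.
  have d4 := @is_derive1_comp _ W (fun y => y + e) x _ _ d1 d3.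
  apply: is_derive_eq.
  by rewrite addr0 mulr1.
rewrite (@continuous_FTC2 _ _ V)//.
- rewrite -EFinB lee_fin lerB// /V.
  + have [|||c cb ->] := @MVT _ W H b (b + e).
    * lra.
    * by move=> x; rewrite in_itv/= => /andP[bx _]; apply: dW; lra.
    * by apply: cW; lra.
    rewrite (_ : b + e - b = e); last by ring.
    rewrite mulrC mulfK ?gt_eqF//.
    by rewrite Hb//; move: cb; rewrite in_itv/= => /andP[/ltW].
  + have [|||c cb ->] := @MVT _ W H a (a + e).
    * lra.
    * by move=> x; rewrite in_itv/= => /andP[bx _]; apply: dW; lra.
    * by apply: cW; lra.
    rewrite (_ : a + e - a = e); last by ring.
    rewrite mulrC mulfK ?gt_eqF//.
    by apply: ndH; move: cb; rewrite in_itv/= => /andP[/ltW].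
- exact/continuous_subspaceT/continuous_increment.
- have cV (x : R) : a - 1 < x -> {for x, continuous V}.
    move=> ax; have [dVx _] := dV x ax.
    exact/differentiable_continuous/derivable1_diffP.
  split.
  + move=> x; rewrite in_itv/= => /andP[ax _]; have ax1 : a - 1 < x by lra.
    by have [] := dV x ax1.
  + by apply: cvg_at_right_filter; apply: cV; lra.
  + by apply: cvg_at_left_filter; apply: cV; lra.
- move=> x; rewrite in_itv/= => /andP[ax _]; rewrite derive1E.
  have ax1 : a - 1 < x by lra.
  by have [] := dV x ax1.
Qed.

(* Fatou's lemma applied to the difference quotients of H. *)
Lemma integral_derive_le H h a b : a < b -> continuous H ->
  {homo H : x y / x <= y} -> (forall x, b <= x -> H x = H b) ->
  measurable_fun `[a, b] h ->
  {ae mu, forall x, x \in `]a, b[ -> is_derive x 1 H (h x)} ->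
  (\int[mu]_(x in `[a, b]) `|(h x)%:E| <= (H b - H a)%:E)%E.
Proof.
move=> ab cH ndH Hb mh H'h.
pose Q (n : nat) (x : R) := (n.+1%:R * (H (x + n.+1%:R^-1) - H x)).
have mQ n : measurable_fun `[a, b] (fun x => (Q n x)%:E).
  apply/measurable_EFinP; apply: subspace_continuous_measurable_fun => //.
  exact/continuous_subspaceT/continuous_increment.
have Q0 n x : (0 <= (Q n x)%:E)%E.
  by rewrite lee_fin mulr_ge0// subr_ge0 ndH// lerDl.
have Qh (x : R) : is_derive x 1 H (h x) -> Q n x @[n --> \oo] --> `|h x|.
  case=> dH <-.
  under eq_fun do rewrite -[Q _ x]ger0_norm -?lee_fin//.
  apply: cvg_norm.
  have /cvgr_dnbhsP : (t^-1 *: (H (t *: 1 + x) - H x)) @[t --> 0^'] --> 'D_1 H x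
    by exact: dH.
  move=> /(_ (fun n => n.+1%:R^-1)) /= dHx.
  rewrite (_ : (fun n => Q n x) = fun n =>
    (n.+1%:R^-1)^-1 *: (H (n.+1%:R^-1 *: 1 + x) - H x)).
    apply: dHx; split=> [n|]; last exact: cvg_harmonic.
    by rewrite invr_neq0.
  by apply/funext => n; rewrite invrK /Q; congr (_ * (H _ - _));
    rewrite addrC [X in _ = X + _]mulr1.
rewrite (@ae_eq_integral _ _ _ mu `[a, b] (fun x => limn_einf (fun n =>
  (Q n x)%:E)) (fun x => `|(h x)%:E|)%E) //; last 3 first.
- by apply: measurableT_comp => //; exact/measurable_EFinP.
- under eq_fun do rewrite /limn_einf.
  apply: measurableT_comp => //; apply: measurable_fun_limn_esup => n.
  by apply: measurableT_comp => //; exact: mQ.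
- have ae_neq (c : R) : {ae mu, forall x, x != c}.
    exists [set c]; split; [exact: measurable_set1|exact: lebesgue_measure_set1|].
    by move=> x /= /negP; rewrite negbK => /eqP.
  have FF := ae_filter_ringOfSetsType mu.
  move: H'h (ae_neq a) (ae_neq b); apply: filterS3 => x xh xa xb /= xab.
  have /Qh Qx : is_derive x 1 H (h x).
    apply: xh; move: xab; rewrite !in_itv/= => /andP[ax bx].
    by rewrite !lt_neqAle ax bx xb eq_sym xa.
  apply/esym; apply: (cvg_limn_einf_sup _).1.
  by apply: cvg_EFin => //; apply: nearW.
apply: le_trans.
  exact: (@fatou _ _ _ mu `[a, b] _ (fun n x => (Q n x)%:E)).
rewrite limn_einf_lim; apply: lime_le; first exact: is_cvg_einfs.
apply: nearW => n.
apply: (@le_trans _ _ (\int[mu]_(x in `[a, b]) (Q n x)%:E)%E).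
  by apply: ereal_inf_lbound; exists n => /=.
have := @integral_increment_le H a b n.+1%:R^-1 _ ab cH ndH Hb.
by rewrite invrK; apply.
Qed.


Lemma Rintegral_itv_increment g a u v : a <= u -> u <= v ->
  mu.-integrable `[a, v] (EFin \o g) ->
  \int[mu]_(x in `[u, v]) g x =
  \int[mu]_(x in `[a, v]) g x - \int[mu]_(x in `[a, u]) g x.
Proof.
move=> au uv ig; rewrite Rintegral_itvB//.
rewrite Rintegral_itv_obnd_cbnd//; apply: integrableS ig => //.
by apply: subset_itvr; rewrite bnd_simp.
Qed.

(** Composition with this retraction onto [a, b] extends a function by constants to the whole line,
    the form in which [integral_derive_le] takes its argument. *)
Definition clamp a b (x : R) := Num.max a (Num.min x b).

Lemma clampP a b x : a <= b -> a <= clamp a b x <= b.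
Proof. by move=> ab; rewrite /clamp le_max lexx/= ge_max ab ge_min lexx orbT. Qed.

Lemma clamp_id a b x : a <= x <= b -> clamp a b x = x.
Proof. by move=> /andP[ax xb]; rewrite /clamp min_l// max_r. Qed.

Lemma clamp_homo a b : {homo clamp a b : x y / x <= y}.
Proof.
move=> x y xy; rewrite /clamp ge_max !le_max lexx/= !le_min !ge_min lexx xy /=.
by rewrite orbT orbT.
Qed.

Lemma continuous_clamp a b : continuous (clamp a b).
Proof.
move=> x; apply/cvgrPdist_lt => e e0; near=> y.
apply: (@le_lt_trans _ _ `|x - y|).
  have [xy|/ltW yx] := leP x y.
    have cxy := clamp_homo a b xy.
    rewrite distrC [leRHS]distrC !ger0_norm ?subr_ge0//.
    rewrite /clamp /Num.max /Num.min in cxy *; do !case: ifPn; lra.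
  have cxy := clamp_homo a b yx; rewrite !ger0_norm ?subr_ge0//.
  rewrite /clamp /Num.max /Num.min in cxy *; do !case: ifPn; lra.
near: y; exact: cvgr_dist_lt.
Unshelve. all: by end_near. Qed.

Lemma continuous_comp_clamp f a b : a <= b -> {within `[a, b], continuous f} ->
  continuous (f \o clamp a b).
Proof.
move=> ab /subspace_continuousP cf x.
have /cf fx : `[a, b]%classic (clamp a b x) by rewrite /= in_itv/= clampP.
apply: (cvg_comp (clamp a b) f) fx.
move=> A /= [e e0 eA]; have := @continuous_clamp a b x; move/cvgrPdist_lt => /(_ _ e0).
by apply: filterS => y /= xy; apply: eA => //=; rewrite in_itv/= clampP.
Qed.

Lemma is_derive_comp_clamp f a b (x d : R) : x \in `]a, b[ ->
  is_derive x 1 f d -> is_derive x 1 (f \o clamp a b) d.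
Proof.
rewrite in_itv/= => /andP[ax xb]; apply: near_eq_is_derive => //.
near=> y; rewrite /= clamp_id//; apply/andP; split; near: y.
- by apply: filterS (lt_nbhsr ax) => y; exact: ltW.
- by apply: filterS (lt_nbhsl xb) => y; exact: ltW.
Unshelve. all: by end_near. Qed.

Lemma dominated_continuous_clamp f g a b : a <= b ->
  mu.-integrable `[a, b] (EFin \o g) ->
  (forall u v, a <= u -> u <= v -> v <= b ->
     `|f v - f u| <= \int[mu]_(x in `[u, v]) g x) ->
  continuous (f \o clamp a b).
Proof.
move=> ab ig fg.
pose G x := \int[mu]_(t in `[a, x]) g t.
have fG u v : a <= u -> u <= v -> v <= b -> `|f v - f u| <= G v - G u.
  move=> au uv vb; rewrite (le_trans (fg _ _ au uv vb))//.
  rewrite (Rintegral_itv_increment au uv)//.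
  by apply: integrableS ig => //; apply: subset_itvl; rewrite bnd_simp.
have cG : continuous (G \o clamp a b).
  apply: continuous_comp_clamp => //.
  exact: parameterized_integral_continuous ab ig.
move=> x; apply/cvgrPdist_lt => e e0; have /cvgrPdist_lt/(_ e e0) := cG x.
apply: filterS => y /=; apply: le_lt_trans.
have := clampP x ab; have := clampP y ab.
move=> /andP[ay yb] /andP[ax xb].
have [xy|/ltW xy] := leP (clamp a b x) (clamp a b y).
  by rewrite distrC [leRHS]distrC (le_trans (fG _ _ ax xy yb))// ler_norm.
by rewrite (le_trans (fG _ _ ay xy xb))// ler_norm.
Qed.

Lemma dominated_within_continuous f g a b : a <= b ->
  mu.-integrable `[a, b] (EFin \o g) ->
  (forall u v, a <= u -> u <= v -> v <= b ->
     `|f v - f u| <= \int[mu]_(x in `[u, v]) g x) ->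
  {within `[a, b], continuous f}.
Proof.
move=> ab ig fg; have cf := dominated_continuous_clamp ab ig fg.
apply: (@subspace_eq_continuous _ _ _ (f \o clamp a b)); last exact: continuous_subspaceT.
by move=> x; rewrite inE/= in_itv/= => xab; rewrite /from_subspace/= clamp_id.
Qed.

(** Let G be the primitive of g. For s = 1 and s = -1, G + s f is nondecreasing because g dominates
    the increments of f, so [integral_derive_le] bounds the integral of |g + s h| by the increment
    of G + s f. The integral of g cancels, and the two signs give the two inequalities. *)
Theorem dominated_ftc f g h a b : a < b ->
  mu.-integrable `[a, b] (EFin \o g) ->
  (forall u v, a <= u -> u <= v -> v <= b ->
     `|f v - f u| <= \int[mu]_(x in `[u, v]) g x) ->
  measurable_fun `[a, b] h ->
  {ae mu, forall x, x \in `]a, b[ -> is_derive x 1 f (h x)} ->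
  mu.-integrable `[a, b] (EFin \o h) /\
  \int[mu]_(x in `[a, b]) h x = f b - f a.
Proof.
move=> ab ig fg mh f'h.
have mg : measurable_fun `[a, b] g by apply/measurable_EFinP; exact: measurable_int ig.
pose G x := \int[mu]_(t in `[a, x]) g t.
have igx x : x <= b -> mu.-integrable `[a, x] (EFin \o g).
  by move=> xb; apply: integrableS ig => //; apply: subset_itvl; rewrite bnd_simp.
have fG u v : a <= u -> u <= v -> v <= b -> `|f v - f u| <= G v - G u.
  move=> au uv vb; rewrite (le_trans (fg _ _ au uv vb))//.
  by rewrite (Rintegral_itv_increment au uv)//; exact: igx.
have G'g : {ae mu, forall x, x \in `]a, b[ -> is_derive x 1 G (g x)}.
  (* [FTC1] asks for integrability on [a, y] for every y, also beyond b, so g is extended by 0. *)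
  pose gab := g \_ `[a, b].
  have iT : mu.-integrable setT (EFin \o gab).
    by move: ig; rewrite integrable_mkcond//= restrict_EFin.
  have /FTC1 : forall y, mu.-integrable [set` Interval (BLeft a) (BRight y)] (EFin \o
    gab).
    by move=> y; apply: integrableS iT.
  move=> /(_ (integrable_locally _ ig)) /= => /(_ (measurable_itv _)).
  have FF := ae_filter_ringOfSetsType mu.
  apply: filterS => x /= dx; rewrite in_itv/= => /andP[ax xb].
  have [|d1 d2] := dx; first by [].
  have : is_derive x 1 (fun x => \int[mu]_(t in `[a, x]) gab t) (g x).
    apply: DeriveDef => //; rewrite -derive1E d2 /gab patchE mem_set//= in_itv/=.
    by rewrite !ltW.
  apply: near_eq_is_derive => //; near=> y.
  apply: eq_Rintegral => z; rewrite inE/= in_itv/= => /andP[az zy].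
  rewrite /gab patchE mem_set//= in_itv/= az/= (le_trans zy)//.
  by near: y; apply: filterS (lt_nbhsl xb) => y; exact: ltW.
have cG : continuous (G \o clamp a b).
  apply: continuous_comp_clamp; first exact: ltW.
  exact: parameterized_integral_continuous (ltW ab) ig.
have cf : continuous (f \o clamp a b) := dominated_continuous_clamp (ltW ab) ig fg.
have key (s : R) : `|s| = 1 ->
  (\int[mu]_(x in `[a, b]) `|(g x + s * h x)%:E| <= (G b - G a + s * (f b - f a))%:E)%E.
  move=> s1.
  pose H x := (G \o clamp a b) x + s * (f \o clamp a b) x.
  have -> : G b - G a + s * (f b - f a) = H b - H a.
    by rewrite /H /= !clamp_id ?lexx ?(ltW ab)//; ring.
  apply: integral_derive_le => //.
  - move=> x; apply: cvgD; first exact: cG.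
    by apply: cvgM; [exact: cvg_cst|exact: cf].
  - move=> x y xy; rewrite -subr_ge0 /H/=.
    have := clampP x (ltW ab); have := clampP y (ltW ab).
    move=> /andP[ay yb] /andP[ax xb].
    have := fG _ _ ax (clamp_homo a b xy) yb.
    have : - (s * (f (clamp a b y) - f (clamp a b x))) <= `|f (clamp a b y) - f (clamp
      a b x)|.
      by rewrite -[leRHS]mul1r -s1 -normrM -normrN ler_norm.
    lra.
  - by move=> x bx; rewrite /H/= /clamp minxx (min_r bx).
  - apply: measurable_funD => //; exact: measurable_funM.
  - have FF := ae_filter_ringOfSetsType mu.
    move: G'g f'h; apply: filterS2 => x Gx fx xab.
    have Gx' := is_derive_comp_clamp xab (Gx xab).
    have fx' := is_derive_comp_clamp xab (fx xab).
    exact: is_deriveD.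
have mk (s : R) : measurable_fun `[a, b] (fun x => g x + s * h x).
  by apply: measurable_funD => //; exact: measurable_funM.
have ik (s : R) : `|s| = 1 -> mu.-integrable `[a, b] (EFin \o (fun x => g x + s * h x)).
  move=> s1; apply/integrableP; split; first by apply/measurable_EFinP; exact: mk.
  by rewrite (le_lt_trans (key _ s1))// ltry.
have ih : mu.-integrable `[a, b] (EFin \o h).
  have i1 := ik 1 (normr1 _).
  apply: (eq_integrable _ _ _ _ (integrableB _ i1 ig)) => //= x _.
  by rewrite -EFinB; congr EFin; ring.
split => //.
have ik' (s : R) : `|s| = 1 -> s * \int[mu]_(x in `[a, b]) h x <= s * (f b - f a).
  move=> s1; have := key s s1.
  have ishs : mu.-integrable `[a, b] (EFin \o (fun x => s * h x)).
    by apply: (eq_integrable _ _ _ _ (integrableZl _ s ih)).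
  have : `|\int[mu]_(x in `[a, b]) (g x + s * h x)| <= \int[mu]_(x in `[a,
    b]) `|g x + s * h x|.
    by apply: le_normr_Rintegral => //; exact: ik.
  rewrite RintegralD// RintegralZl// => le1 le2.
  have {}le2 : \int[mu]_(x in `[a, b]) `|g x + s * h x| <= G b - G a + s * (f b - f a).
    rewrite -lee_fin /Rintegral fineK//.
    by apply: integrable_fin_num => //; apply: integrable_norm (ik s s1).
  have Ga : G a = 0 by rewrite /G set_itv1 Rintegral_set1.
  by have := le_trans (ler_norm _) (le_trans le1 le2); rewrite Ga subr0 /G lerD2l.
apply/eqP; rewrite eq_le; apply/andP; split.
  by have := ik' 1 (normr1 _); rewrite !mul1r.
by have := ik' (-1) (normrN1 _); rewrite !mulN1r lerN2.
Unshelve. all: by end_near. Qed.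
End absolutely_continuous_ftc.

(** * Series with nonnegative terms and generating functions *)

Section nonnegative_series.
Context {R : realType}.
Implicit Types (a b : nat -> R) (x y : R).

Lemma nneseries_EFinP a : (forall k, 0 <= a k) ->
  (\sum_(k <oo) (a k)%:E < +oo)%E <-> cvgn (series a).
Proof.
move=> a0.
have sE n : (\sum_(0 <= k < n) (a k)%:E)%E = (series a n)%:E by rewrite sumEFin.
split=> [aoo|ca]; last first.
  under eq_fun do rewrite sE.
  by have := EFin_lim ca; rewrite /comp => ->; rewrite ltry.
apply: nondecreasing_is_cvgn.
  by apply: nondecreasing_series => *; exact: a0.
exists (fine (\sum_(k <oo) (a k)%:E)%E) => _ [n _ <-].
rewrite -lee_fin fineK; last first.
  by rewrite ge0_fin_numE// nneseries_ge0// => k _ _; rewrite lee_fin.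
by rewrite -sE; apply: nneseries_lim_ge => k _ _; rewrite lee_fin.
Qed.

Lemma EFin_limn_series a : cvgn (series a) ->
  ((limn (series a))%:E = \sum_(k <oo) (a k)%:E)%E.
Proof.
move=> ca; rewrite -EFin_lim//; congr (limn _); apply/funext => n /=.
by rewrite sumEFin.
Qed.

Lemma continuous_sum (I : Type) (r : seq I) (f : I -> R -> R) y :
  (forall i, {for y, continuous (f i)}) ->
  {for y, continuous (fun x => \sum_(i <- r) f i x)}.
Proof.
move=> cf; elim: r => [|i r IH].
  by rewrite (_ : (fun _ => _) = fun=> 0); [exact: cvg_cst|apply/funext => x;
    rewrite big_nil].
rewrite (_ : (fun _ => _) = fun x => f i x + \sum_(i <- r) f i x).
  by apply: cvgD; [exact: cf|exact: IH].
by apply/funext => x; rewrite big_cons.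
Qed.

(** Monotone convergence along the left neighbourhoods of 1, with limit possibly [+oo]. By
    monotonicity the sum at 1 bounds the sums on its left; conversely, a partial sum at 1 that
    exceeds M still does so near 1, by continuity of finitely many terms. *)
Lemma nneseries_cvg_left1 b (P : nat -> R -> R) : (forall k, 0 <= b k) ->
  (forall k, {in `[0, 1] &, {homo P k : x y / x <= y}}) ->
  (forall k, 0 <= P k 0) -> (forall k, {for 1, continuous (P k)}) ->
  (\sum_(k <oo) (b k * P k x)%:E)%E @[x --> 1^'-] --> (\sum_(k <oo) (b k * P k 1)%:E)%E.
Proof.
move=> b0 ndP P0 cP.
have P_ge0 k x : 0 <= x <= 1 -> 0 <= P k x.
  move=> /andP[x0 x1]; rewrite (le_trans (P0 k))// ndP// in_itv/= ?lexx ?ler01//.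
  by rewrite x0.
have t0 k x : 0 <= x <= 1 -> (0 <= (b k * P k x)%:E)%E.
  by move=> ?; rewrite lee_fin mulr_ge0// P_ge0.
have I1 : 0 <= (1:R) <= 1 by rewrite ler01 lexx.
have fin n : (\sum_(0 <= k < n) (b k * P k x)) @[x --> 1^'-] -->
    (\sum_(0 <= k < n) (b k * P k 1)).
  apply: cvg_at_left_filter.
  apply: (@continuous_sum _ _ (fun k x => b k * P k x)) => k.
  by apply: cvgM; [exact: cvg_cst|exact: cP].
set S := (\sum_(k <oo) (b k * P k 1)%:E)%E.
have up : \forall x \near 1^'-, (\sum_(k <oo) (b k * P k x)%:E <= S)%E.
  near=> x.
  have x01 : 0 <= x <= 1.
    by apply/andP; split; near: x; [apply: nbhs_left_ge;
      exact: ltr01|exact: nbhs_left_le].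
  have := x01 => /andP[x0 x1].
  apply: lee_nneseries => [k _ _|k _]; first exact: t0.
  by rewrite lee_fin ler_wpM2l// ndP// in_itv/= ?x01// ?lexx ?ler01.
have lo (M : R) : (M%:E < S)%E ->
    \forall x \near 1^'-, (M%:E < \sum_(k <oo) (b k * P k x)%:E)%E.
  move=> MS.
  have [n Mn] : exists n, (M%:E < \sum_(0 <= k < n) (b k * P k 1)%:E)%E.
    apply: contrapT => /forallNP h; move: MS; apply/negP; rewrite -leNgt.
    apply: lime_le; first by apply: is_cvg_nneseries => k _ _; exact: t0.
    by apply: nearW => n; rewrite leNgt; apply/negP; exact: h.
  have : \forall x \near 1^'-, (M%:E < \sum_(0 <= k < n) (b k * P k x)%:E)%E.
    have /cvgr_gt := fin n; move=> /(_ M); move: Mn; rewrite sumEFin lte_fin.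
    by move=> Mn /(_ Mn); apply: filterS => x; rewrite sumEFin lte_fin.
  move=> Mx; near=> x.
  have x01 : 0 <= x <= 1.
    by apply/andP; split; near: x; [apply: nbhs_left_ge;
      exact: ltr01|exact: nbhs_left_le].
  apply: (@lt_le_trans _ _ (\sum_(0 <= k < n) (b k * P k x)%:E)%E); first by near: x.
  by apply: nneseries_lim_ge => k _ _; exact: t0.
have : (0 <= S)%E by apply: nneseries_ge0 => k _ _; exact: t0.
case E : S => [s| |]// s0; rewrite E in up lo.
- apply/fine_cvgP; split.
    near=> x; rewrite ge0_fin_numE; last first.
      apply: nneseries_ge0 => k _ _; apply: t0.
      by apply/andP; split; near: x; [apply: nbhs_left_ge;
        exact: ltr01|exact: nbhs_left_le].
    by apply: (@le_lt_trans _ _ s%:E); [near: x; exact: up|rewrite ltry].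
  apply/cvgrPdist_lt => e e0; near=> x.
  have h1 : (\sum_(k <oo) (b k * P k x)%:E <= s%:E)%E by near: x; exact: up.
  have h2 : ((s - e)%:E < \sum_(k <oo) (b k * P k x)%:E)%E.
    by near: x; apply: lo; rewrite lte_fin ltrBlDr ltrDl.
  rewrite /=; move: h1 h2; case: (\sum_(k <oo) (b k * P k x)%:E)%E => //= r.
  rewrite lee_fin lte_fin => h1 h2.
  by rewrite ger0_norm ?subr_ge0// ltrBlDr -ltrBlDl.
- by apply/cvgeyPgt => A; apply: lo; rewrite ltry.
Unshelve. all: by end_near. Qed.

(** For k >= 1 this is (y - y^k) / (1 - y). For k = 0 that quotient would be -1 while the empty sum
    is 0, hence the correction term in [mul_geo] and the separate treatment of the coefficient of
    index 0. *)
Definition geo (k : nat) (y : R) : R := \sum_(1 <= i < k) y ^+ i.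

Lemma geo0 y : geo 0 y = 0. Proof. by rewrite /geo big_geq. Qed.
Lemma geo_at1 k : geo k 1 = k.-1%:R.
Proof.
rewrite /geo; under eq_bigr do rewrite expr1n.
by rewrite big_const_nat iter_addr_0 subn1.
Qed.

Lemma geo_ge0 k y : 0 <= y -> 0 <= geo k y.
Proof. by move=> y0; apply: sumr_ge0 => i _; exact: exprn_ge0. Qed.

Lemma geo_homo k : {in `[0, 1] &, {homo geo k : x y / x <= y}}.
Proof.
move=> x y; rewrite !in_itv/= => /andP[x0 _] /andP[y0 _] xy.
by apply: ler_sum => i _; rewrite lerXn2r.
Qed.

Lemma continuous_geo k : continuous (geo k).
Proof.
move=> y; apply: (@continuous_sum _ _ (fun i x => x ^+ i)) => i.
exact: exprn_continuous.
Qed.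

Lemma mul_geo k y : (1 - y) * geo k y = y - y ^+ k + (k == 0%N)%:R * (1 - y).
Proof.
case: k => [|k]; first by rewrite geo0 expr0 mulr0 eqxx mul1r addrC subrKA subrr.
rewrite mul0r addr0; elim: k => [|k IH]; first by rewrite /geo big_geq// mulr0 subrr.
by rewrite /geo big_nat_recr//= mulrDr -/(geo k.+1 _) IH [y ^+ k.+2]exprS; ring.
Qed.

Lemma geo_le k y : 0 <= y < 1 -> geo k y <= (1 - y)^-1.
Proof.
move=> /andP[y0 y1]; have y1' : 0 < 1 - y by rewrite subr_gt0.
rewrite -(ler_pM2l y1') divff ?gt_eqF// mul_geo.
case: k => [|k]; first by rewrite expr0 eqxx mul1r; lra.
by rewrite mul0r addr0; have := exprn_ge0 k.+1 y0; lra.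
Qed.
End nonnegative_series.

(** * The quotient of the Herglotz function by 1 - y *)

Section herglotz_quotient.
Context {R : realType}.
Implicit Types (q : R) (a b : nat -> R) (x y : R).

(* If Phi is the Herglotz function of (q, a), then Jq q a y = Phi(y) / (1 - y) + a_0. *)
Definition Jq q a y : \bar R :=
  ((q * (y / (1 - y)))%:E + \sum_(k <oo) (a k * geo k y)%:E)%E.

Lemma geo_term_ge0 a y k : (forall k, 0 <= a k) -> 0 <= y ->
  (0 <= (a k * geo k y)%:E)%E.
Proof. by move=> a0 y0; rewrite lee_fin mulr_ge0// geo_ge0. Qed.

Lemma Jq_ge0 q a y : 0 <= q -> (forall k, 0 <= a k) -> 0 <= y < 1 -> (0 <= Jq q a y)%E.
Proof.
move=> q0 a0 /andP[y0 y1]; rewrite adde_ge0//.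
  by rewrite lee_fin mulr_ge0// divr_ge0// subr_ge0 ltW.
by apply: nneseries_ge0 => k _ _; exact: geo_term_ge0.
Qed.

Lemma Jq_homo q a x y : 0 <= q -> (forall k, 0 <= a k) -> 0 <= x -> x <= y -> y < 1 ->
  (Jq q a x <= Jq q a y)%E.
Proof.
move=> q0 a0 x0 xy y1; apply: leeD.
  rewrite lee_fin ler_wpM2l// ler_pM// ?invr_ge0 ?subr_ge0 ?(ltW (le_lt_trans xy y1))//.
  rewrite lef_pV2 ?posrE ?subr_gt0//; last exact: le_lt_trans y1.
  by rewrite lerB.
apply: lee_nneseries => [k _ _|k _]; first exact: geo_term_ge0.
rewrite lee_fin ler_wpM2l// geo_homo// in_itv/=.
  by rewrite x0 (le_trans xy)// ltW.
by rewrite (le_trans x0 xy) ltW.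
Qed.

Lemma cvg_geo_series a y : (forall k, 0 <= a k) -> cvgn (series a) -> 0 <= y < 1 ->
  cvgn (series (fun k => a k * geo k y)).
Proof.
move=> a0 ca /andP[y0 y1].
apply: (@series_le_cvg _ _ (fun k => (1 - y)^-1 * a k)).
- by move=> k; rewrite mulr_ge0// geo_ge0.
- by move=> k; rewrite mulr_ge0// invr_ge0 subr_ge0 ltW.
- by move=> k; rewrite mulrC ler_wpM2r// geo_le// y0.
- by apply: is_cvg_seriesZ.
Qed.

Lemma Jq_EFin q a y : (forall k, 0 <= a k) -> cvgn (series a) -> 0 <= y < 1 ->
  Jq q a y = (q * (y / (1 - y)) + limn (series (fun k => a k * geo k y)))%:E.
Proof. by move=> a0 ca y01; rewrite /Jq -EFin_limn_series//; exact: cvg_geo_series. Qed.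

Lemma cvg_series_herglotz a y : (forall k, 0 <= a k) -> cvgn (series a) -> 0 <= y < 1 ->
  series (fun n => a n * (y - y ^+ n)) @ \oo -->
  (1 - y) * (limn (series (fun k => a k * geo k y)) - a 0%N).
Proof.
move=> a0 ca y01.
have cg := cvg_geo_series a0 ca y01.
suff : (fun n => (1 - y) * (series (fun k => a k * geo k y) n - a 0%N)) @ \oo -->
  (1 - y) * (limn (series (fun k => a k * geo k y)) - a 0%N).
  (* The partial sums agree only from n = 1 on, once they contain the term of index 0. *)
  apply: cvg_trans; apply: near_eq_cvg; exists 1%N => //= n n0.
  rewrite mulrBr /series/= mulr_sumr.
  transitivity (\sum_(0 <= k < n) (a k * (y - y ^+ k) + (k == 0%N)%:R * (a k * (1 -
    y))) - (1 - y) * a 0%N).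
    by congr (_ - _); apply: eq_bigr => k _; rewrite mulrCA mul_geo mulrDr;
      congr (_ + _); ring.
  rewrite big_split/= [X in _ + X - _](_ : _ = (1 - y) * a 0%N) ?addrK//.
  rewrite big_ltn// big_nat big1 ?addr0 ?eqxx ?mul1r 1?mulrC//.
  by move=> k /andP[k0 _]; rewrite gtn_eqF// mul0r.
by apply: cvgM; [exact: cvg_cst|apply: cvgB; [exact: cg|exact: cvg_cst]].
Qed.

Lemma herglotz_Jq q a y : (forall k, 0 <= a k) -> cvgn (series a) -> 0 <= y < 1 ->
  q * y + limn (series (fun n => a n * (y - y ^+ n))) = (1 - y) * (fine (Jq q a y) - a
    0%N).
Proof.
move=> a0 ca y01; rewrite (cvg_lim _ (cvg_series_herglotz a0 ca y01))//.
rewrite Jq_EFin//= -addrA [RHS]mulrDr; congr (_ + _).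
move: y01 => /andP[_ y1].
by field; rewrite subr_eq0 gt_eqF.
Qed.

(** With the convention 0 * oo = 0, [q%:E * +oo] is 0 for q = 0 and [+oo] for q > 0, which is the
    limit of q y / (1 - y) in both cases. *)
Lemma Jq_cvg_left1 q a : 0 <= q -> (forall k, 0 <= a k) ->
  Jq q a y @[y --> 1^'-] --> (q%:E * +oo + \sum_(k <oo) (a k * k.-1%:R)%:E)%E.
Proof.
move=> q0 a0.
have S0 : (0 <= \sum_(k <oo) (a k * k.-1%:R)%:E)%E.
  by apply: nneseries_ge0 => k _ _; rewrite lee_fin mulr_ge0.
have cS : (\sum_(k <oo) (a k * geo k x)%:E)%E @[x --> 1^'-] --> (\sum_(k <oo) (a k *
  k.-1%:R)%:E)%E.
  under [X in _ --> X]eq_eseriesr do rewrite -geo_at1.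
  apply: nneseries_cvg_left1 => // k;
    [exact: geo_homo|exact: geo_ge0|exact: continuous_geo].
apply: cvgeD => //.
  move: q0; rewrite le_eqVlt => /predU1P[<-|q0].
    by rewrite mul0e.
  by rewrite gt0_muley ?lte_fin//; case: (\sum_(k <oo) _)%E S0.
move: q0; rewrite le_eqVlt => /predU1P[<-|q0].
  rewrite mul0e; under eq_fun do rewrite mul0r; exact: cvg_cst.
rewrite gt0_muley ?lte_fin//; apply/cvgeryP/cvgryPge => A.
near=> y.
have y1 : y < 1 by near: y; exact: nbhs_left_lt.
have y2 : 2^-1 <= y by near: y; apply: nbhs_left_ge; lra.
(* The factor 2 compensates y >= 1/2, so that q y / (1 - y) >= |A| + 1. *)
have yA : 1 - y < (2 * (`|A| + 1) / q)^-1.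
  by near: y; apply: nbhs_left_ltBl; rewrite invr_gt0 divr_gt0// mulr_gt0// ltr_wpDl.
have A1 : 0 < 2 * (`|A| + 1) / q by rewrite divr_gt0// mulr_gt0// ltr_wpDl.
have h : 2 * (`|A| + 1) / q < (1 - y)^-1.
  by rewrite -[ltLHS]invrK ltf_pV2 ?posrE ?invr_gt0 ?subr_gt0.
rewrite (le_trans (ler_norm A))// (@le_trans _ _ (q * (2^-1 * (2 * (`|A| + 1) / q))))//.
  rewrite [leRHS](_ : _ = `|A| + 1) ?lerDl//; field; exact: lt0r_neq0.
by rewrite ler_wpM2l ?(ltW q0)// ler_pM// ltW.
Unshelve. all: by end_near. Qed.
End herglotz_quotient.

(** * Power series with nonnegative coefficients: derivatives and limits at 1 *)

Section generating_function.
Context {R : realType}.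
Implicit Types (q : R) (a b : nat -> R) (x y z : R).

Definition gf a x : R := limn (series (fun n => a n * x ^+ n)).

Lemma gf_cvg a x : (forall k, 0 <= a k) -> cvgn (series a) -> 0 <= x <= 1 ->
  cvgn (series (fun n => a n * x ^+ n)).
Proof.
move=> a0 ca /andP[x0 x1]; apply: (@series_le_cvg _ _ a) => // k.
- by rewrite mulr_ge0// exprn_ge0.
- by rewrite ler_piMr// exprn_ile1.
Qed.

Lemma gf_EFin a x : cvgn (series (fun n => a n * x ^+ n)) ->
  ((gf a x)%:E = \sum_(n <oo) (a n * x ^+ n)%:E)%E.
Proof. exact: EFin_limn_series. Qed.

Lemma gf_ge0 a x : (forall k, 0 <= a k) -> cvgn (series a) -> 0 <= x <= 1 -> 0 <= gf a x.
Proof.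
move=> a0 ca /[dup] x01 /andP[x0 _]; rewrite -lee_fin gf_EFin; last exact: gf_cvg.
by apply: nneseries_ge0 => k _ _; rewrite lee_fin mulr_ge0// exprn_ge0.
Qed.

Lemma gf_homo a x y : (forall k, 0 <= a k) -> cvgn (series a) -> 0 <= x -> x <= y ->
  y <= 1 ->
  gf a x <= gf a y.
Proof.
move=> a0 ca x0 xy y1; rewrite -lee_fin !gf_EFin; last 2 first.
- by apply: gf_cvg => //; rewrite (le_trans x0 xy) y1.
- by apply: gf_cvg => //; rewrite x0 (le_trans xy).
apply: lee_nneseries => [k _ _|k _]; first by rewrite lee_fin mulr_ge0// exprn_ge0.
by rewrite lee_fin ler_wpM2l// lerXn2r// nnegrE// (le_trans x0).
Qed.

(* The bound (n+1) z^n (y - z) <= y^(n+1) makes the derived series converge. *)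
Lemma cvg_pseries_diffs a y z : (forall k, 0 <= a k) -> 0 <= z < y ->
  cvgn (pseries a y) -> cvgn (pseries (pseries_diffs a) z).
Proof.
move=> a0 /andP[z0 zy] cy.
have yz : 0 < y - z by rewrite subr_gt0.
apply: (@series_le_cvg _ _ (fun n => (y - z)^-1 * (a n.+1 * y ^+ n.+1))).
- by move=> n; rewrite !mulr_ge0// exprn_ge0.
- move=> n; apply: mulr_ge0; first by rewrite invr_ge0 ltW.
  by rewrite mulr_ge0// exprn_ge0// (le_trans z0)// ltW.
- move=> n; rewrite /pseries_diffs/= mulrAC [leRHS]mulrCA mulrC ler_wpM2l//.
  rewrite ler_pdivlMl//.
  apply: (@le_trans _ _ (y ^+ n.+1 - z ^+ n.+1)); last by rewrite gerBl exprn_ge0.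
  rewrite subrXX ler_wpM2l ?(ltW yz)// mulr_natl -[n.+1 in leLHS]card_ord -sumr_const.
  apply: ler_sum => i _; rewrite /= ?subSS.
  rewrite -[in leLHS](subnK (ltn_ord i : (i <= n)%N)) exprD ler_wpM2r ?exprn_ge0//.
  by rewrite lerXn2r// ?nnegrE// ?(le_trans z0)// ltW.
- apply: is_cvg_seriesZ.
  have -> : series (fun n => a n.+1 * y ^+ n.+1) = (fun n =>
    pseries a y n.+1 - a 0%N * y ^+ 0).
    by apply/funext => n; rewrite /pseries/series/= big_nat_recl// addrC addKr.
  apply: is_cvgB; last exact: is_cvg_cst.
  by apply/cvg_ex; exists (limn (pseries a y)); rewrite (cvg_shiftS (pseries a y)).
Qed.

Lemma pseries1 a : pseries a 1 = series a.
Proof.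
by rewrite /pseries; congr series; apply/funext => k /=; rewrite expr1n mulr1.
Qed.

Lemma is_derive_gf a x : (forall k, 0 <= a k) -> cvgn (series a) -> 0 <= x < 1 ->
  is_derive x 1 (gf a) (gf (pseries_diffs a) x).
Proof.
move=> a0 ca /andP[x0 x1].
(* [pseries_snd_diffs] needs the series and its first two derived series at a point beyond x. Each
   differentiation costs part of the radius, hence x < K2 < K3 < 1. *)
pose K2 := (x + 1) / 2; pose K3 := (K2 + 1) / 2.
have c2 : cvgn (pseries a K2) by apply: gf_cvg => //; rewrite /K3 /K2; lra.
have d0 k : 0 <= pseries_diffs a k by rewrite mulr_ge0.
have c1 : cvgn (pseries a 1) by rewrite pseries1.
have d3 : cvgn (pseries (pseries_diffs a) K3).
  by apply: (@cvg_pseries_diffs _ 1) => //; rewrite /K3 /K2; lra.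
have d2 : cvgn (pseries (pseries_diffs a) K2).
  by apply: (@cvg_pseries_diffs _ 1) => //; rewrite /K3 /K2; lra.
have dd2 : cvgn (pseries (pseries_diffs (pseries_diffs a)) K2).
  by apply: (@cvg_pseries_diffs _ K3) => //; rewrite /K3 /K2; lra.
apply: pseries_snd_diffs c2 d2 dd2 _.
rewrite !ger0_norm// /K2; lra.
Qed.

(** Abel's theorem for nonnegative coefficients. Convergence is asked only below 1, so that it also
    covers derived series, whose sum at 1 may be infinite. *)
Lemma gf_cvg_left1 a : (forall k, 0 <= a k) ->
  (forall x, 0 <= x < 1 -> cvgn (series (fun n => a n * x ^+ n))) ->
  (gf a x)%:E @[x --> 1^'-] --> (\sum_(k <oo) (a k)%:E)%E.
Proof.
move=> a0 ca.
have -> : (\sum_(k <oo) (a k)%:E)%E = (\sum_(k <oo) (a k * 1 ^+ k)%:E)%E.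
  by apply: eq_eseriesr => k _; rewrite expr1n mulr1.
have : (\sum_(n <oo) (a n * x ^+ n)%:E)%E @[x --> 1^'-] --> (\sum_(n <oo) (a n * 1 ^+
  n)%:E)%E.
  apply: (nneseries_cvg_left1 (P := fun k x => x ^+ k)) => // k.
  - by move=> x y; rewrite !in_itv/= => /andP[x0 _] /andP[y0 _] xy; rewrite lerXn2r.
  - exact: exprn_continuous.
apply: cvg_trans; apply: near_eq_cvg; near=> x.
rewrite gf_EFin//; apply: ca => //; apply/andP.
by split; near: x; [apply: nbhs_left_ge; exact: ltr01|exact: nbhs_left_lt].
Unshelve. all: by end_near. Qed.

Lemma gf_left1 a : (forall k, 0 <= a k) -> cvgn (series a) ->
  (gf a x)%:E @[x --> 1^'-] --> (\sum_(k <oo) (a k)%:E)%E.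
Proof.
move=> a0 ca; apply: gf_cvg_left1 => // x /andP[x0 x1].
by apply: gf_cvg => //; rewrite x0 ltW.
Qed.

Lemma gf_diffs_left1 a : (forall k, 0 <= a k) -> cvgn (series a) ->
  (gf (pseries_diffs a) x)%:E @[x --> 1^'-] --> (\sum_(k <oo) (k%:R * a k)%:E)%E.
Proof.
move=> a0 ca.
rewrite nneseries_recl//; last by move=> k _; rewrite lee_fin mulr_ge0.
rewrite mul0r add0e -(nneseries_addn 1); last by move=> k; rewrite lee_fin mulr_ge0.
rewrite (eq_eseriesr (g := fun k => (pseries_diffs a k)%:E)); last first.
  by move=> k _; rewrite addn1.
apply: gf_cvg_left1 => [k|x x01]; first by rewrite mulr_ge0.
apply: (@cvg_pseries_diffs _ 1) => //.
by rewrite pseries1.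
Qed.

Lemma derive_gf_left1 a : (forall k, 0 <= a k) -> cvgn (series a) ->
  (derive1 (gf a) x)%:E @[x --> 1^'-] --> (\sum_(k <oo) (k%:R * a k)%:E)%E.
Proof.
move=> a0 ca; have := gf_diffs_left1 a0 ca; apply: cvg_trans.
apply: near_eq_cvg; near=> x.
have x01 : 0 <= x < 1.
  by apply/andP; split; near: x; [apply: nbhs_left_ge; exact: ltr01|exact: nbhs_left_lt].
by rewrite derive1E; have [_ ->] := is_derive_gf a0 ca x01.
Unshelve. all: by end_near. Qed.
End generating_function.

(** * The Herglotz function on the real axis *)

Section complex_to_real.
Context {R : realType}.
Local Open Scope complex_scope.

Lemma real_complexX (x : R) n : (x%:C) ^+ n = (x ^+ n)%:C.
Proof. by rewrite rmorphXn. Qed.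

Lemma cmod_real (x : R) : cmod x%:C = `|x|.
Proof. by rewrite /cmod /= expr0n/= addr0 sqrtr_sqr. Qed.

Lemma pgf_real (p : N0s -> R) (x : R) : pgf p x%:C = (gf (fun k => p (Some k)) x)%:C.
Proof.
rewrite /pgf /cseries; congr (_ +i* _).
  by congr (limn (series _)); apply/funext => n; rewrite real_complexX.
rewrite [X in series X](_ : _ = fun=> 0).
  by rewrite (_ : series _ = fun=> 0) ?lim_cst//; apply/funext => n;
    rewrite /series/= big1.
by apply/funext => n; rewrite real_complexX /= mulr0.
Qed.

Lemma on_reals_pgf (p : N0s -> R) : on_reals (pgf p) = gf (fun k => p (Some k)).
Proof. by apply/funext => x; rewrite /on_reals pgf_real. Qed.

(** The coefficients as they occur in [herglotz]; sums restricted to n <> 1 become plain series. *)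
Definition offdiag (a : nat -> R) (n : nat) : R := if n == 1%N then 0 else a n.

Lemma on_reals_herglotz (q : R -> R) (alpha : R -> nat -> R) t x :
  on_reals (herglotz q alpha ^~ t) x =
  q t * x + limn (series (fun n => offdiag (alpha t) n * (x - x ^+ n))).
Proof.
rewrite /on_reals /herglotz /cseries /= !mul0r subr0; congr (_ + limn (series _)).
by apply/funext => n; rewrite real_complexX.
Qed.
End complex_to_real.

Section herglotz_left1.
Context {R : realType}.
Implicit Types (a : nat -> R).

Lemma offdiag_ge0 a n : (forall k, 0 <= a k) -> 0 <= offdiag a n.
Proof. by move=> a0; rewrite /offdiag; case: ifP. Qed.

Lemma offdiag_geo a n x : offdiag a n * geo n x = a n * geo n x.
Proof.
by rewrite /offdiag; case: eqP => // ->; rewrite /geo big_geq// !mulr0.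
Qed.

Lemma Jq_offdiag q a x : Jq q (offdiag a) x = Jq q a x.
Proof. by congr (_ + _)%E; apply: eq_eseriesr => n _; rewrite offdiag_geo. Qed.

Lemma nneseries_offdiag a (w : nat -> R) : (forall k, 0 <= a k) -> (forall k, 0 <= w k) ->
  (\sum_(n <oo | n != 1%N) (w n * a n)%:E = \sum_(n <oo) (w n * offdiag a n)%:E)%E.
Proof.
move=> a0 w0; rewrite eseries_mkcond; apply: eq_eseriesr => n _.
by rewrite /offdiag; case: eqP => //; rewrite mulr0.
Qed.

(** For k >= 2, x - x^k >= x (1 - x) > 0, so the terms control those of [series a]; [tr] cuts off
    the indices 0 and 1, where no such bound holds. By contraposition, divergent rates make the
    Herglotz series diverge at every x in (0, 1). *)
Lemma cvg_series_of_herglotz a x : (forall k, 0 <= a k) -> 0 < x < 1 ->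
  cvgn (series (fun n => a n * (x - x ^+ n))) -> cvgn (series a).
Proof.
move=> a0 /andP[x0 x1].
have xx0 : 0 < x * (1 - x) by rewrite mulr_gt0// subr_gt0.
have xle k : (1 < k)%N -> x * (1 - x) <= x - x ^+ k.
  move=> k1; rewrite mulrBr mulr1 lerB// -expr2.
  by rewrite ler_wiXn2l ?(ltW x0) ?(ltW x1).
pose tr (u : nat -> R) k := if (k < 2)%N then 0 else u k.
have trP (u : nat -> R) : cvgn (series u) = cvgn (series (tr u)).
  rewrite -(is_cvg_series_restrict 2) -[RHS](is_cvg_series_restrict 2).
  rewrite [X in cvgn X = _](_ : _ = [sequence \sum_(2 <= k < n) tr u k]_n)//.
  apply/funext => n; apply: eq_big_nat => k /andP[k2 _].
  by rewrite /tr ltnNge k2.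
rewrite (trP (fun n => a n * (x - x ^+ n))) (trP a) => cx.
apply: (@series_le_cvg _ _ (fun k => (x * (1 - x))^-1 * tr (fun n =>
  a n * (x - x ^+ n)) k)).
- by move=> k; rewrite /tr; case: ifP.
- move=> k; rewrite /tr mulr_ge0 ?invr_ge0 ?(ltW xx0)//.
  case: ltnP => // k2; rewrite mulr_ge0//.
  exact: le_trans (ltW xx0) (xle _ k2).
- move=> k; rewrite /tr; case: ltnP => k2; first by rewrite mulr0.
  by rewrite ler_pdivlMl// mulrC ler_wpM2l// xle.
- exact: is_cvg_seriesZ.
Qed.

Lemma limn_series_herglotz a x : (forall k, 0 <= a k) -> cvgn (series a) -> 0 <= x <= 1 ->
  limn (series (fun n => a n * (x - x ^+ n))) = limn (series a) * x - gf a x.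
Proof.
move=> a0 ca x01; apply/cvg_lim => //.
have -> : series (fun n => a n * (x - x ^+ n)) =
    (fun n => series a n * x - series (fun n => a n * x ^+ n) n).
  apply/funext => n; rewrite /series/= mulr_suml -sumrB.
  by apply: eq_bigr => k _; rewrite mulrBr.
by apply: cvgB; [apply: cvgM; [exact: ca|exact: cvg_cst]|exact: gf_cvg].
Qed.

Lemma near_left1 : \forall x \near (1 : R)^'-, 0 < x < 1.
Proof.
near=> x; apply/andP; split; near: x; last exact: nbhs_left_lt.
by apply: nbhs_left_gt; exact: ltr01.
Unshelve. all: by end_near. Qed.

(** The series equals B x - [gf a x] with B the total rate, and both terms tend to B. *)
Lemma herglotz_left1 q a : (forall k, 0 <= a k) -> cvgn (series a) ->
  (q * x + limn (series (fun n => a n * (x - x ^+ n))))%:E @[x --> 1^'-] --> q%:E.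
Proof.
move=> a0 ca; set B := limn (series a).
suff : (q * x + (B * x - gf a x)) @[x --> 1^'-] --> q * 1 + (B * 1 - B).
  rewrite mulr1 mulr1 subrr addr0 => h; apply: cvg_EFin; first exact: nearW.
  apply: cvg_trans h; apply: near_eq_cvg; apply: filterS near_left1 => x /andP[x0 x1] /=.
  by rewrite limn_series_herglotz// (ltW x0) ltW.
have xl : x @[x --> (1:R)^'-] --> (1:R) by apply: cvg_at_left_filter; exact: cvg_id.
apply: cvgD; first by apply: cvgM => //; exact: cvg_cst.
apply: cvgB; first by apply: cvgM => //; exact: cvg_cst.
have := gf_left1 a0 ca; rewrite -EFin_limn_series//.
by move/fine_cvgP => [].
Qed.

(** Termwise k = (k - 1) + 1 for k >= 1, while at k = 0 both the weight and the truncated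
    predecessor vanish; hence the total mass enters without [a 0]. *)
Lemma nneseries_mean a : (forall k, 0 <= a k) -> cvgn (series a) ->
  (\sum_(k <oo) (k%:R * a k)%:E = \sum_(k <oo) (a k * k.-1%:R)%:E + (limn (series a) -
    a 0%N)%:E)%E.
Proof.
move=> a0 ca.
have -> : (\sum_(k <oo) (k%:R * a k)%:E = \sum_(k <oo) ((a k * k.-1%:R)%:E + ((k !=
  0%N)%:R * a k)%:E))%E.
  apply: eq_eseriesr => k _; rewrite -EFinD; congr EFin.
  by case: k => [|k]; rewrite /= ?mul0r ?mulr0 ?addr0// mul1r -addn1 natrD; ring.
rewrite nneseriesD; last 2 first.
- by move=> k _ _; rewrite lee_fin mulr_ge0.
- by move=> k _ _; rewrite lee_fin mulr_ge0.
congr (_ + _)%E.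
rewrite EFinB EFin_limn_series// nneseries_recl//; last by move=> k _;
  rewrite lee_fin mulr_ge0.
rewrite mul0r add0e [in RHS]nneseries_recl//; last by move=> k _; rewrite lee_fin.
rewrite addeC addeA (_ : (- (a 0)%:E + (a 0)%:E = 0)%E) ?add0e;
  last by rewrite -EFinN -EFinD addNr.
congr (limn _); apply/funext => n; apply: eq_big_nat => k /andP[k1 _].
by rewrite -lt0n k1 mul1r.
Qed.

(** The function is (q + B) x - [gf a x] with B the total rate. Its derivative tends to q + B minus
    the sum of k a_k, and [nneseries_mean] cancels B, also when that sum is infinite. *)
Lemma derive_herglotz_left1 q a : (forall k, 0 <= a k) -> cvgn (series a) ->
  (derive1 (fun x => q * x + limn (series (fun n => a n * (x - x ^+ n)))) x)%:E
    @[x --> 1^'-] --> ((q + a 0%N)%:E - \sum_(k <oo) (a k * k.-1%:R)%:E)%E.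
Proof.
move=> a0 ca; set B := limn (series a).
have -> : ((q + a 0%N)%:E - \sum_(k <oo) (a k * k.-1%:R)%:E =
    (q + B)%:E - \sum_(k <oo) (k%:R * a k)%:E)%E.
  rewrite nneseries_mean// -/B.
  have : (0 <= \sum_(k <oo) (a k * k.-1%:R)%:E)%E.
    by apply: nneseries_ge0 => k _ _; rewrite lee_fin mulr_ge0.
  case: (\sum_(k <oo) (a k * k.-1%:R)%:E)%E => [r| |]// _.
  by rewrite -EFinD -!EFinB; congr EFin; ring.
have : ((q + B)%:E - (gf (pseries_diffs a) x)%:E)%E @[x --> 1^'-] -->
    ((q + B)%:E - \sum_(k <oo) (k%:R * a k)%:E)%E.
  apply: cvgeB; [by rewrite fin_num_adde_defr|exact: cvg_cst|exact: gf_diffs_left1].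
apply: cvg_trans; apply: near_eq_cvg; apply: filterS near_left1 => x /andP[x0 x1].
rewrite -EFinB; congr EFin; rewrite derive1E.
have dg : is_derive x 1 (gf a) (gf (pseries_diffs a) x).
  by apply: is_derive_gf => //; rewrite (ltW x0).
have d1 : is_derive x 1 (fun y : R =>
  q * y + (B * y - gf a y)) (q * 1 + (B * 1 - gf (pseries_diffs a) x)).
  by apply: is_deriveD.
have : is_derive x 1 (fun x => q * x + limn (series (fun n =>
  a n * (x - x ^+ n)))) (q * 1 + (B * 1 - gf (pseries_diffs a) x)).
  apply: near_eq_is_derive d1; near=> y; rewrite limn_series_herglotz//.
  apply/andP; split; near: y.
    by apply: filterS (lt_nbhsr x0) => y; exact: ltW.
  by apply: filterS (lt_nbhsl x1) => y; exact: ltW.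
by case=> _ ->; rewrite !mulr1 addrA.
Unshelve. all: by end_near. Qed.

(* For a divergent series of rates, [limn] takes the junk value 0. *)
Lemma derive_herglotz_left1_dvg q a : (forall k, 0 <= a k) -> ~ cvgn (series a) ->
  (derive1 (fun x => q * x + limn (series (fun n => a n * (x - x ^+ n)))) x)%:E
    @[x --> 1^'-] --> q%:E.
Proof.
move=> a0 ca; have : q%:E @[x --> (1:R)^'-] --> q%:E by exact: cvg_cst.
apply: cvg_trans; apply: near_eq_cvg; apply: filterS near_left1 => x /andP[x0 x1].
congr EFin; rewrite derive1E.
have d1 : is_derive x 1 (fun y : R => q * y) (q * 1) by apply: is_deriveZ.
have : is_derive x 1 (fun x => q * x + limn (series (fun n =>
  a n * (x - x ^+ n)))) (q * 1).
  apply: near_eq_is_derive d1; near=> y.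
  rewrite [limn _]dvgP ?addr0//; apply: contra_not ca.
  apply: cvg_series_of_herglotz => //.
  apply/andP; split; near: y; [exact: lt_nbhsr|exact: lt_nbhsl].
by case=> _ ->; rewrite mulr1.
Unshelve. all: by end_near. Qed.

End herglotz_left1.

(** * Transition probabilities and expectations *)

Section convolution_mean.
Context {R : realType}.

Lemma limn_series_single (k : nat) (c : R) :
  limn (series (fun j => (j == k)%:R * c)) = c.
Proof.
apply/cvg_lim => //; have : (fun _ : nat => c) @ \oo --> c by exact: cvg_cst.
apply: cvg_trans; apply: near_eq_cvg; exists k.+1 => // n /= kn.
rewrite /series/= (bigD1_seq k) ?mem_index_iota ?iota_uniq ?kn//= eqxx mul1r big1
  ?addr0//.
by move=> j /negbTE ->; rewrite mul0r.
Qed.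

(** Additivity of the mean, by Tonelli on the triangular array [w] and the splitting k = i + (k -
    i). Both means may be infinite. *)
Lemma mean_convolution (u v : nat -> R) : (forall k, 0 <= u k) -> (forall k, 0 <= v k) ->
  (\sum_(k <oo) (u k)%:E = 1)%E -> (\sum_(k <oo) (v k)%:E = 1)%E ->
  (\sum_(k <oo) (k%:R * \sum_(i < k.+1) u (i : nat) * v (k - i)%N)%:E =
   \sum_(k <oo) (k%:R * u k)%:E + \sum_(k <oo) (k%:R * v k)%:E)%E.
Proof.
move=> u0 v0 u1 v1.
pose w i k : \bar R := if (i <= k)%N then (k%:R * (u i * v (k - i)%N))%:E else 0%E.
have w0 i k : (0 <= w i k)%E by rewrite /w; case: ifP => // _; rewrite lee_fin !mulr_ge0.
transitivity (\sum_(k <oo) \sum_(i <oo) w i k)%E.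
  apply: eq_eseriesr => k _.
  rewrite (@nneseries_split _ _ 0 k.+1)// add0n.
  rewrite [X in (_ + X)%E]eseries0 ?adde0; last by move=> i ki _; rewrite /w leqNgt ki.
  rewrite mulr_sumr -sumEFin big_mkord; apply: eq_bigr => i _.
  by rewrite /w -ltnS ltn_ord.
rewrite nneseries_interchange//.
transitivity (\sum_(i <oo) ((i%:R * u i)%:E + (u i)%:E * \sum_(k <oo) (k%:R * v k)%:E))%E.
  apply: eq_eseriesr => i _.
  rewrite (@nneseries_split _ _ 0 i)// add0n.
  rewrite [X in (X + _)%E]big_nat_cond big1 ?add0e; last first.
    by move=> k /andP[/andP[_ ki] _]; rewrite /w leqNgt ki.
  rewrite -(nneseries_addn i)//.
  transitivity (\sum_(j <oo) ((i%:R * u i)%:E * (v j)%:E + (u i)%:E * (j%:R * v j)%:E))%E.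
    apply: eq_eseriesr => j _; rewrite /w leq_addl addnK natrD -!EFinM -EFinD;
      congr EFin; ring.
  rewrite nneseriesD; last 2 first.
  - by move=> j _ _; rewrite -EFinM lee_fin !mulr_ge0.
  - by move=> j _ _; rewrite -EFinM lee_fin !mulr_ge0.
  rewrite !nneseriesZl; last 2 first.
  - by move=> j _; rewrite lee_fin mulr_ge0.
  - by move=> j _; rewrite lee_fin.
  by rewrite v1 mule1.
have V0 : (0 <= \sum_(k <oo) (k%:R * v k)%:E)%E.
  by apply: nneseries_ge0 => k _ _; rewrite lee_fin mulr_ge0.
rewrite nneseriesD; last 2 first.
- by move=> j _ _; rewrite lee_fin !mulr_ge0.
- by move=> j _ _; rewrite mule_ge0// lee_fin.
congr (_ + _)%E.
move: V0; set V := (\sum_(k <oo) (k%:R * v k)%:E)%E => V0.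
case: V V0 => [r _| _|//].
  under eq_eseriesr do rewrite muleC.
  by rewrite nneseriesZl ?u1 ?mule1// => i _; rewrite lee_fin.
(* If the mean of v is infinite, one index with u i > 0, which exists since u has mass 1, makes the
   sum infinite. *)
have [i ui] : exists i, 0 < u i.
  apply: contrapT => /forallNP un; move: u1; rewrite eseries0;
    first by move=> [] /esym/eqP; rewrite oner_eq0.
  by move=> i _ _; congr EFin; apply/eqP; rewrite eq_le u0 andbT leNgt; apply/negP.
rewrite (@nneseries_pinfty _ _ _ i)//; last by rewrite gt0_muley// lte_fin.
by move=> j _; rewrite mule_ge0// lee_fin.
Qed.
End convolution_mean.


Section process_expectation.
Context {R : realType} (d : measure_display) (Omega : measurableType d).
Variables (P : R -> N0s -> probability Omega R) (N : R -> Omega -> N0s).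
Variable ell : R -> R -> N0s -> N0s -> R.
Hypothesis bp : branching_process P N ell.

Lemma measurable_preimage_N0s t (B : set N0s) : 0 <= t -> measurable (N t @^-1` B).
Proof.
move=> t0; case: bp => _ mN _ _.
rewrite (_ : _ @^-1` _ = \bigcup_(k : N0s) (if k \in B then N t @^-1` [set k] else set0)).
  apply: countable_bigcupT_measurable; first exact: countableP.
  by move=> k; case: ifP => _; [exact: mN|exact: measurable0].
apply/seteqP; split => w /=.
  by move=> Bw; exists (N t w) => //=; rewrite mem_set.
by move=> [k _]; case: ifPn => // /set_mem Bk /= ->.
Qed.

Lemma measurable_fun_N0s t d' (U : measurableType d') (f : N0s -> U) : 0 <= t ->
  measurable_fun setT (fun w => f (N t w)).
Proof.
move=> t0 _ B mB; rewrite setTI.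
exact: (@measurable_preimage_N0s t (f @^-1` B)).
Qed.

Lemma kint_indicator (mu : N0s -> R) k : kint mu (fun m => (m == k)%:R) = mu k.
Proof.
rewrite /kint; case: k => [k|] /=.
  rewrite mulr0 add0r.
  rewrite (_ : (fun j => _) = fun j => (j == k)%:R * mu (Some k));
    first exact: limn_series_single.
  by apply/funext => j; rewrite eqE /=; case: (eqVneq j k) => [->|]; rewrite mulrC ?mul0r.
rewrite mulr1 (_ : series _ = fun=> 0) ?lim_cst ?addr0//.
by apply/funext => n; rewrite /series/= big1// => j _; rewrite mulr0.
Qed.

(** The Markov property conditioned at the starting time s, for the whole space and the indicator of
    k. Since N_s = n almost surely under [P s n], the integrand on the right is almost surely
    constant. *)
Lemma transition_probability s u n k : 0 <= s <= u ->
  P s n (N u @^-1` [set k]) = (ell s u n k)%:E.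
Proof.
move=> /andP[s0 su]; have u0 := le_trans s0 su.
case: (bp) => _ mN Ps markov.
have := @markov s s u n setT (fun m => (m == k)%:R).
rewrite s0 lexx => /(_ isT su).
have bf : exists M : R, forall x : N0s, `|(x == k)%:R| <= M.
  by exists 1 => x; case: (x == k); rewrite ?normr1 ?normr0.
have fT : nat_filtration N s s [set: Omega].
  by rewrite -[setT]setD0; apply: sigma_algebraCD; exact: sigma_algebra0.
move=> /(_ bf fT).
rewrite (_ : \int[P s n]_w ((N u w == k)%:R)%:E = P s n (N u @^-1` [set k]))%E;
  last first.
  rewrite (eq_integral (fun w => (\1_(N u @^-1` [set k]) w)%:E)).
    by rewrite integral_indic ?setIT//; exact: mN.
  move=> w _; rewrite indicE; congr ((nat_of_bool _)%:R%:E).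
  by apply/idP/idP => [/eqP h|/set_mem/= ->//]; apply/mem_set.
move=> ->.
rewrite (@ae_eq_integral _ _ _ (P s n) setT (cst (ell s u n k)%:E)) //.
- by rewrite integral_cst// [X in (_ * X)%E](@probability_setT _ _ _ (P s n)) mule1.
- exact: (@measurable_fun_N0s s _ _ (fun m => (kint (ell s u m) (fun m =>
  (m == k)%:R))%:E)).
exists (~` (N s @^-1` [set n])); split.
- by apply: measurableC; exact: mN.
- by rewrite [LHS](@probability_setC _ _ _ (P s n)) ?Ps ?subee//; exact: mN.
- by move=> w /= h Nw; apply: h => _; rewrite Nw kint_indicator.
Qed.

Lemma expectE s n u : 0 <= s <= u ->
  expect P N s n u = ((ell s u n None)%:E * +oo + \sum_(k <oo) (k%:R * ell s u n (Some
    k))%:E)%E.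
Proof.
move=> su; have /andP[s0 su'] := su; have u0 := le_trans s0 su'.
case: (bp) => [[pr _ _ _ _] mN _ _].
have [ell0 _] := pr s u n su.
(* An enumeration of the states with oo at index 0 and k at index k + 1: the integral splits into a
   series over the level sets of N_u. *)
pose st (j : nat) : N0s := if j is k.+1 then Some k else None.
pose F j := N u @^-1` [set st j].
have UF : setT = \bigcup_j F j.
  apply/seteqP; split => // w _; rewrite /F.
  case E : (N u w) => [k|]; [exists k.+1|exists 0%N] => //=.
have e0 m : (0 <= @extN0s R m)%E by case: m => [k|] //=; rewrite lee_fin.
rewrite /expect UF ge0_integral_bigcup//; last 3 first.
- by move=> j; exact: mN.
- by rewrite -UF; exact: (measurable_fun_N0s (@extN0s R)).
- apply/trivIsetP => i j _ _ ij; rewrite -subset0 => w []; rewrite /F /= => h1 h2.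
  move: ij; apply/negP; rewrite negbK; move: h1; rewrite h2.
  by case: i j {h2} => [|i] [|j] //= [->].
transitivity (\sum_(j <oo) (extN0s (st j) * (ell s u n (st j))%:E))%E.
  apply: eq_eseriesr => j _; rewrite -transition_probability//.
  rewrite -integral_cst; last exact: mN.
  by apply: eq_integral => w /set_mem /= ->.
rewrite nneseries_recl//=; last by move=> j _; rewrite mule_ge0// lee_fin.
rewrite muleC; congr (_ + _)%E.
rewrite -(nneseries_addn 1); last by move=> j; rewrite mule_ge0// lee_fin.
by apply: eq_eseriesr => k _; rewrite addn1.
Qed.

(** Induction on n by the branching property: the law from n + 1 individuals is the convolution of
    those from 1 and from n. Without mass at oo these have total mass 1 on the integers, as
    [mean_convolution] demands. *)
Lemma transition_mean s u n : 0 <= s <= u -> ell s u (Some 1%N) None = 0 ->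
  ell s u (Some n) None = 0 /\
  (\sum_(k <oo) (k%:R * ell s u (Some n) (Some k))%:E =
   n%:R%:E * \sum_(k <oo) (k%:R * ell s u (Some 1%N) (Some k))%:E)%E.
Proof.
move=> su p0; case: (bp) => [[pr _ _ _ /(_ s u su)[cv l0 _]] _ _ _].
elim: n => [|n [IH1 IH2]].
  split; first by rewrite l0 /dirac_N0s.
  rewrite mul0e; apply: eseries0 => k _ _; rewrite l0 /dirac_N0s eqE /=.
  by case: k => [|k]; rewrite ?mul0r ?mulr0.
have E k : ell s u (Some n.+1) k = Defs.conv (ell s u (Some 1%N)) (ell s u (Some n)) k.
  by rewrite -cv.
split; first by rewrite E /= p0 IH1 mul0r mulr0 addr0.
under eq_eseriesr do rewrite E /=.
have mass1 m : ell s u m None = 0 -> (\sum_(k <oo) (ell s u m (Some k))%:E = 1)%E.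
  by move=> m0; have [_] := pr s u m su; rewrite m0 add0e.
have e0 m k : 0 <= ell s u m k by have [] := pr s u m su.
rewrite (@mean_convolution _ (fun k => ell s u (Some 1%N) (Some k)) (fun k =>
  ell s u (Some n) (Some k))) ?mass1//.
rewrite IH2 -[n.+1]addn1 natrD EFinD ge0_muleDl ?lee_fin// mul1e addeC//.
Qed.

End process_expectation.

(** * The evolution family on the real axis *)

Section prob_generating_function.
Context {R : realType} (mu : N0s -> R).
Hypothesis pmu : is_prob mu.
Let p k := mu (Some k).

Lemma is_prob_ge0 k : 0 <= p k.
Proof. by case: pmu => + _; apply. Qed.

Lemma is_prob_cvg : cvgn (series p).
Proof.
case: pmu => mu0 mu1; apply/nneseries_EFinP; first exact: is_prob_ge0.
rewrite (@le_lt_trans _ _ 1%E) ?ltry//.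
by rewrite -mu1 leeDr// lee_fin; exact: mu0.
Qed.

Lemma is_prob_lim : limn (series p) = 1 - mu None.
Proof.
case: pmu => mu0; rewrite -EFin_limn_series; last exact: is_prob_cvg.
by rewrite -EFinD => -[] <-; rewrite addrC addKr.
Qed.

(** Since the masses add up to 1, x - F(x) is itself a Herglotz function, with p_k as rates and the
    mass at oo in the role of q. *)
Lemma gf_herglotz x : 0 <= x < 1 ->
  x - gf p x = mu None * x + (1 - x) * (limn (series (fun k => p k * geo k x)) - p 0%N).
Proof.
move=> /[dup] x01 /andP[x0 x1].
rewrite -(cvg_lim _ (cvg_series_herglotz is_prob_ge0 is_prob_cvg x01))//.
rewrite limn_series_herglotz ?x0 ?(ltW x1)//; [|exact: is_prob_ge0|exact: is_prob_cvg].
by rewrite is_prob_lim; ring.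
Qed.

Lemma gf_Jq x : 0 <= x < 1 ->
  1 - gf p x = (1 - x) * (fine (Jq (mu None) p x) + 1 - p 0%N).
Proof.
move=> /[dup] x01 /andP[x0 x1].
rewrite (_ : 1 - gf p x = (1 - x) + (x - gf p x)); last by ring.
rewrite gf_herglotz// Jq_EFin//=; [|exact: is_prob_ge0|exact: is_prob_cvg].
by field; rewrite subr_eq0 gt_eqF.
Qed.

Lemma gf_at0 : gf p 0 = p 0%N.
Proof.
apply/cvg_lim => //; have : (fun _ : nat => p 0%N) @ \oo --> p 0%N by exact: cvg_cst.
apply: cvg_trans; apply: near_eq_cvg; exists 1%N => // n /= n0.
rewrite /series/= big_ltn// expr0 mulr1 big_nat big1 ?addr0// => k /andP[k1 _].
by rewrite expr0n gtn_eqF// mulr0.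
Qed.

Let r := limn (series (fun k => (1 < k)%:R * p k)).

Let cvg_r : cvgn (series (fun k => (1 < k)%:R * p k)).
Proof.
apply: (@series_le_cvg _ _ p) is_prob_cvg => k; last 1 first.
- by case: ltnP => _; rewrite ?mul1r ?mul0r// is_prob_ge0.
- by rewrite mulr_ge0// is_prob_ge0.
- exact: is_prob_ge0.
Qed.

Let rE : 1 - p 1%N = p 0%N + mu None + r.
Proof.
have h1 : (fun n => p 0%N + p 1%N + series (fun k =>
  (1 < k)%:R * p k) n) @ \oo --> p 0%N + p 1%N + r.
  by apply: cvgD; [exact: cvg_cst|exact: cvg_r].
have h2 : series p @ \oo --> p 0%N + p 1%N + r.
  apply: cvg_trans h1; apply: near_eq_cvg; exists 2%N => // n /= n2.
  have split2 (u : nat -> R) : series u n = u 0%N + u 1%N + \sum_(2 <= k < n) u k.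
    by rewrite /series/= big_ltn ?(ltn_trans _ n2)// big_ltn// addrA.
  rewrite [RHS]split2 (split2 (fun k => _)) !mul0r !add0r; congr (_ + _).
  by apply: eq_big_nat => k /andP[k1 _]; rewrite k1 mul1r.
have E : 1 - mu None = p 0%N + p 1%N + r.
  by rewrite -is_prob_lim; apply: cvg_lim.
have -> : 1 = p 0%N + p 1%N + r + mu None by rewrite -E subrK.
by ring.
Qed.

Let S x := limn (series (fun k => p k * geo k x)).

Let S_ge0 x : 0 <= x < 1 -> 0 <= S x.
Proof.
move=> /[dup] x01 /andP[x0 x1]; apply: limr_ge.
  exact: cvg_geo_series is_prob_ge0 is_prob_cvg x01.
by apply: nearW => n; apply: sumr_ge0 => k _; rewrite mulr_ge0 ?is_prob_ge0 ?geo_ge0.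
Qed.

Let S_le x : 0 <= x < 1 -> (1 - x) * S x <= r.
Proof.
move=> /[dup] x01 /andP[x0 x1].
have cS := cvg_geo_series is_prob_ge0 is_prob_cvg x01.
have h : (fun n => (1 - x) * series (fun k => p k * geo k x) n) @ \oo --> (1 - x) * S x.
  by apply: cvgM; [exact: cvg_cst|exact: cS].
apply: ler_cvg_to h cvg_r _; apply: nearW => n; rewrite /series/= mulr_sumr.
apply: ler_sum => k _; rewrite mulrCA mul_geo.
have xk := exprn_ge0 k x0; have pk := is_prob_ge0 k.
case: k xk pk => [|[|k]] xk pk; last 1 first.
- by rewrite mul0r addr0 mul1r ler_piMr//; move: xk; lra.
- by rewrite expr0 eqxx mul1r mul0r (_ : x - 1 + (1 - x) = 0) ?mulr0//; ring.
- by rewrite expr1 subrr !mul0r addr0 mulr0.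
Qed.

Let S_half : 4^-1 * r <= 2^-1 * S 2^-1.
Proof.
have h01 : 0 <= (2^-1 : R) < 1.
  by rewrite invr_ge0 ler0n invf_lt1 ?ltr1n.
have cS := cvg_geo_series is_prob_ge0 is_prob_cvg h01.
have h : (fun n => 2^-1 * series (fun k => p k * geo k 2^-1) n) @ \oo --> 2^-1 * S 2^-1.
  by apply: cvgM; [exact: cvg_cst|exact: cS].
have h' : (fun n => 4^-1 * series (fun k => (1 < k)%:R * p k) n) @ \oo --> 4^-1 * r.
  by apply: cvgM; [exact: cvg_cst|exact: cvg_r].
apply: ler_cvg_to h' h _; apply: nearW => n; rewrite /series/= !mulr_sumr.
apply: ler_sum => k _; have pk := is_prob_ge0 k.
case: (ltnP 1 k) => k1; last by rewrite mul0r mulr0 !mulr_ge0// geo_ge0// invr_ge0.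
rewrite mul1r mulrCA mulrC ler_wpM2l//.
have := mul_geo k (2^-1 : R); rewrite (gtn_eqF (ltnW k1)) mul0r addr0.
rewrite (_ : 1 - 2^-1 = 2^-1 :> R); last by field.
(* For k >= 2, 1/2 - (1/2)^k >= 1/4, the origin of the constant. *)
move=> ->; have : (2^-1 : R) ^+ k <= 2^-1 ^+ 2.
  by apply: ler_wiXn2l => //; lra.
by rewrite expr2; lra.
Qed.

(** By [gf_herglotz] and [S_le], x - F(x) lies between -p_0 and p_oo + r, where r is the mass of the
    integers k >= 2 and 1 - p_1 = p_0 + p_oo + r. *)
Lemma gf_displacement x : 0 <= x < 1 -> `|gf p x - x| <= 1 - p 1%N.
Proof.
move=> /[dup] x01 /andP[x0 x1]; rewrite distrC gf_herglotz// rE -/(S x).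
have := S_ge0 x01; have := S_le x01; have := is_prob_ge0 0; have [/(_ None) + _] := pmu.
move: (S x) (mu None) (p 0%N) r => s a b c a0 b0 sc s0.
have s1 : 0 <= (1 - x) * s by rewrite mulr_ge0// subr_ge0 ltW.
by rewrite ler_norml; apply/andP; split; nra.
Qed.

(** F(0) = p_0, and [S_half] gives 1/2 - F(1/2) >= p_oo / 2 + r / 4 - p_0 / 2. Four times this plus
    3 p_0 is at least p_0 + p_oo + r = 1 - p_1. *)
Lemma one_sub_p1_le : 1 - p 1%N <= 3 * gf p 0 + 4 * `|gf p 2^-1 - 2^-1|.
Proof.
rewrite distrC gf_at0 rE.
have := @gf_herglotz 2^-1; rewrite -/(S _) => ->; last lra.
have := S_half; have := is_prob_ge0 0; have [/(_ None) + _] := pmu.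
move: (S _) (mu None) (p 0%N) r => s a b c a0 b0 sc.
set e := (X in `|X|); have := ler_norm e; rewrite /e; lra.
Qed.

End prob_generating_function.

Lemma ln_lipschitz {R : realType} (d x y : R) : 0 < d -> d <= x -> d <= y ->
  `|ln x - ln y| <= d^-1 * `|x - y|.
Proof.
move=> d0.
have h (a b : R) : d <= a -> d <= b -> ln a - ln b <= d^-1 * `|a - b|.
  move=> da db; have a0 := lt_le_trans d0 da; have b0 := lt_le_trans d0 db.
  rewrite -ln_div ?posrE// (_ : a / b = 1 + (a - b) / b); last by field; exact: lt0r_neq0.
  apply: (@le_trans _ _ ((a - b) / b)).
    apply: le_ln1Dx; rewrite ltrNl mulrBl divff ?lt0r_neq0// opprB ltrBlDr ltrDl.
    by rewrite divr_gt0.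
  rewrite mulrC; apply: (@le_trans _ _ (b^-1 * `|a - b|)).
    by rewrite ler_wpM2l ?invr_ge0 ?(ltW b0)// ler_norm.
  by rewrite ler_wpM2r// lef_pV2// posrE.
move=> dx dy; rewrite ler_norml h// andbT lerNl opprB distrC; exact: h.
Qed.

(** * Domination in time and the integral identity *)

Section evolution_family.
Context {R : realType}.
Local Notation leb := (@lebesgue_measure R).
Variable ell : R -> R -> N0s -> N0s -> R.
Variables (q : R -> R) (alpha : R -> nat -> R).
Hypothesis bk : branching_kernels ell.
Hypothesis fam : abs_cont_rev_evol_family (pgfs ell).
Hypothesis gen : generating_family q alpha.
Hypothesis avf : associated_vector_field (pgfs ell) (herglotz q alpha).

Definition offspring (s t : R) (k : nat) : R := ell s t (Some 1%N) (Some k).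
Definition rgf (s t x : R) : R := gf (offspring s t) x.

Lemma pgfs_real s t (x : R) : pgfs ell s t (x%:C)%C = ((rgf s t x)%:C)%C.
Proof. exact: pgf_real. Qed.

Lemma is_prob_ell s t m : 0 <= s <= t -> is_prob (ell s t m).
Proof. by move=> st; case: bk => pr _ _ _ _; exact: pr. Qed.

Lemma offspring_ge0 s t k : 0 <= s <= t -> 0 <= offspring s t k.
Proof. by move=> /(is_prob_ell (Some 1%N)) pr; exact: (is_prob_ge0 pr). Qed.

Lemma offspring_cvg s t : 0 <= s <= t -> cvgn (series (offspring s t)).
Proof. by move=> /(is_prob_ell (Some 1%N)) pr; exact: (is_prob_cvg pr). Qed.

Lemma inD_real (x : R) : inD (x%:C)%C <-> `|x| < 1.
Proof. by rewrite /inD cmod_real. Qed.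

Lemma rgf_itv s t x : 0 <= s <= t -> 0 <= x < 1 -> 0 <= rgf s t x < 1.
Proof.
move=> st /andP[x0 x1].
have f0 : 0 <= rgf s t x.
  apply: gf_ge0; [by move=> k; exact: offspring_ge0|exact: offspring_cvg|].
  by rewrite x0 ltW.
rewrite f0 /= -(ger0_norm f0); apply/inD_real; rewrite -pgfs_real.
by case: fam => h _ _ _; apply: h => //; apply/inD_real; rewrite ger0_norm.
Qed.

Lemma rgf_id s x : 0 <= s -> 0 <= x < 1 -> rgf s s x = x.
Proof.
move=> s0 /andP[x0 x1]; case: fam => _ h _ _.
have : inD (x%:C)%C by apply/inD_real; rewrite ger0_norm.
by move=> /(h s _ s0); rewrite pgfs_real => -[].
Qed.

Lemma rgf_comp s t u x : 0 <= s <= t -> t <= u -> 0 <= x < 1 ->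
  rgf s u x = rgf s t (rgf t u x).
Proof.
move=> st tu /andP[x0 x1]; case: fam => _ _ h _.
have : inD (x%:C)%C by apply/inD_real; rewrite ger0_norm.
by move=> /(h s t u _ st tu); rewrite !pgfs_real => -[].
Qed.

Lemma rgf_homo s t x y : 0 <= s <= t -> 0 <= x -> x <= y -> y < 1 ->
  rgf s t x <= rgf s t y.
Proof.
move=> st x0 xy y1; apply: gf_homo => //; last exact: ltW.
  by move=> k; exact: offspring_ge0.
exact: offspring_cvg.
Qed.

(** Taking both lower times equal in the assumed bound, where F_{s,s} is the identity, dominates the
    displacement at a fixed point. The coefficients 3 and 4 of the majorant are those of
    [one_sub_p1_le]. *)
Lemma displacement_bound : exists2 g : R -> R,
  (forall T, 0 <= T -> leb.-integrable `[0, T] (EFin \o g)) &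
  (forall s u, 0 <= s -> s <= u -> 1 - offspring s u 1 <= \int[leb]_(x in `[s, u]) g x).
Proof.
have D z : 0 <= z < 1 -> exists2 g : R -> R,
    (forall T, 0 <= T -> leb.-integrable `[0, T] (EFin \o g)) &
    (forall s u, 0 <= s -> s <= u -> `|rgf s u z - z| <= \int[leb]_(x in `[s, u]) g x).
  move=> /[dup] z01 /andP[z0 z1]; case: fam => _ _ _ h.
  have zD : inD (z%:C)%C by apply/inD_real; rewrite ger0_norm.
  have [g [gi gb]] := h _ zD; exists g => // s u s0 su.
  have := @gb s s u; rewrite s0 lexx => /(_ isT su).
  rewrite !pgfs_real -rmorphB/= cmod_real rgf_id// /Rintegral.
  have ig : leb.-integrable `[s, u] (EFin \o g).
    apply: integrableS (gi u (le_trans s0 su)) => //.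
    by apply: subset_itvr; rewrite bnd_simp.
  by rewrite -[X in (_ <= X)%E]fineK ?lee_fin//; exact: integrable_fin_num.
have [|g0 ig0 b0] := D 0; first by rewrite lexx ltr01.
have [|g2 ig2 b2] := D 2^-1; first by rewrite invr_ge0 ler0n invf_lt1 ?ltr1n.
have ig T : 0 <= T -> leb.-integrable `[0, T] (EFin \o (fun x => 3 * g0 x)) /\
    leb.-integrable `[0, T] (EFin \o (fun x => 4 * g2 x)).
  move=> T0; split.
    by apply: (eq_integrable _ _ _ _ (integrableZl _ 3 (ig0 T T0))).
  by apply: (eq_integrable _ _ _ _ (integrableZl _ 4 (ig2 T T0))).
exists (fun x => 3 * g0 x + 4 * g2 x) => [T T0|s u s0 su].
  have [i1 i2] := ig T T0.
  by apply: (eq_integrable _ _ _ _ (integrableD _ i1 i2)).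
have su0 : 0 <= s <= u by rewrite s0.
have [i1 i2] := ig u (le_trans s0 su).
have sub : `[s, u] `<=` `[0, u] by apply: subset_itvr; rewrite bnd_simp.
rewrite RintegralD//; [|exact: integrableS i1|exact: integrableS i2].
rewrite !RintegralZl//; [| |].
- rewrite (le_trans (one_sub_p1_le (is_prob_ell _ su0)))//.
  apply: lerD; rewrite ler_wpM2l//; last exact: b2.
  by rewrite (le_trans _ (b0 _ _ s0 su))// subr0 ler_norm.
- by apply: integrableS (ig2 u (le_trans s0 su)).
- by apply: integrableS (ig0 u (le_trans s0 su)).
Qed.

(** Control in the first time, with one majorant for all t and x: the increment is the displacement
    of F_{u,v} at the point F_{v,t}(x). *)
Lemma rgf_dominated : exists2 g : R -> R,
  (forall T, 0 <= T -> leb.-integrable `[0, T] (EFin \o g)) &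
  (forall t x u v, 0 <= x < 1 -> 0 <= u -> u <= v -> v <= t ->
     `|rgf v t x - rgf u t x| <= \int[leb]_(x in `[u, v]) g x).
Proof.
have [g ig gb] := displacement_bound; exists g => // t x u v x01 u0 uv vt.
have uv0 : 0 <= u <= v by rewrite u0.
rewrite (rgf_comp uv0 vt x01) distrC (le_trans _ (gb _ _ u0 uv))//.
apply: (gf_displacement (is_prob_ell _ uv0)).
by apply: rgf_itv => //; rewrite (le_trans u0 uv).
Qed.

Lemma alpha_ge0 r k : 0 <= r -> 0 <= alpha r k.
Proof. by case: gen => _ h _ _ _; exact: h. Qed.

Lemma q_ge0 r : 0 <= r -> 0 <= q r.
Proof. by case: gen => h _ _ _ _; exact: h. Qed.

Lemma measurable_alpha (s t : R) k : 0 <= s -> measurable_fun `[s, t] (fun r =>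
  alpha r k).
Proof.
move=> s0; case: gen => _ _ h _ _; apply: measurable_funS (h k).
  rewrite (_ : [set _ | _] = `[0, +oo[%classic); first exact: measurable_itv.
  by apply/seteqP; split => r /=; rewrite in_itv/= andbT.
by move=> r /=; rewrite in_itv/= => /andP[sr _]; exact: le_trans sr.
Qed.

Lemma q_integrable (s t : R) : 0 <= s <= t -> leb.-integrable `[s, t] (EFin \o q).
Proof.
move=> /andP[s0 st]; case: gen => _ _ _ h _.
apply: integrableS (h t (le_trans s0 st)) => //.
by apply: subset_itvr; rewrite bnd_simp.
Qed.

Lemma measurable_q (s t : R) : 0 <= s <= t -> measurable_fun `[s, t] q.
Proof. by move=> st; apply/measurable_EFinP; exact: measurable_int (q_integrable st). Qed.

Lemma rate_integrable (s t : R) : 0 <= s <= t ->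
  leb.-integrable `[s, t] (fun r => \sum_(n <oo) (offdiag (alpha r) n)%:E)%E.
Proof.
move=> /andP[s0 st]; case: gen => _ a0 _ _ h.
apply: integrableS (_ : leb.-integrable `[0, t] _) => //.
  by apply: subset_itvr; rewrite bnd_simp.
apply: (eq_integrable _ _ _ _ (h t (le_trans s0 st))) => // r.
rewrite inE/= in_itv/= => /andP[r0 _].
under eq_eseriesr do rewrite -[alpha r _]mul1r.
rewrite (nneseries_offdiag (w := fun=> 1))//; last by move=> k; exact: a0.
by under eq_eseriesr do rewrite mul1r.
Qed.

Lemma rate_cvg (s t : R) : 0 <= s <= t ->
  {ae leb, forall r, r \in `[s, t] -> cvgn (series (offdiag (alpha r)))}.
Proof.
move=> st; have /andP[s0 _] := st.
have : {ae leb, forall r, `[s, t]%classic r ->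
    ((\sum_(n <oo) (offdiag (alpha r) n)%:E)%E \is a fin_num)}.
  by apply: integrable_ae => //; exact: rate_integrable.
apply: filterS; first exact: (ae_filter_ringOfSetsType leb).
move=> r /= h rst; apply/nneseries_EFinP.
  by move=> k; apply: offdiag_ge0 => j; apply: alpha_ge0; move: rst;
    rewrite in_itv/= => /andP[/(le_trans s0)].
by have := h rst; rewrite fin_numElt => /andP[].
Qed.

Lemma alpha0_integrable (s t : R) : 0 <= s <= t ->
  leb.-integrable `[s, t] (EFin \o (fun r => alpha r 0%N)).
Proof.
move=> st; have /andP[s0 _] := st.
apply: le_integrable (rate_integrable st) => //.
  by apply/measurable_EFinP; exact: measurable_alpha.
move=> r /=; rewrite in_itv/= => /andP[sr _]; have r0 := le_trans s0 sr.
have o0 k : (0 <= (offdiag (alpha r) k)%:E)%E.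
  by rewrite lee_fin offdiag_ge0// => j; exact: alpha_ge0.
rewrite ger0_norm ?alpha_ge0// gee0_abs; last by apply: nneseries_ge0 => k _ _.
by rewrite nneseries_recl// leeDl//; apply: nneseries_ge0 => k _ _.
Qed.

Lemma rgf_within_continuous (s t x : R) : 0 <= s <= t -> 0 <= x < 1 ->
  {within `[s, t], continuous (fun r => rgf r t x)}.
Proof.
move=> /andP[s0 st] x01; have [g ig gb] := rgf_dominated.
apply: (@dominated_within_continuous _ _ g) => //.
  apply: integrableS (ig t (le_trans s0 st)) => //.
  by apply: subset_itvr; rewrite bnd_simp.
by move=> u v su uv vt; apply: gb => //; exact: le_trans su.
Qed.

(** A positive distance from 1 along the whole trajectory; the logarithm is Lipschitz there, so the
    domination of F passes to ln (1 - F). *)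
Lemma rgf_sup (s t x : R) : 0 <= s <= t -> 0 <= x < 1 ->
  exists2 d, 0 < d & forall r, s <= r <= t -> d <= 1 - rgf r t x.
Proof.
move=> /[dup] st /andP[s0 st'] x01.
have [c] := EVT_max st' (rgf_within_continuous st x01).
rewrite in_itv/= => /andP[sc ct] cmax; exists (1 - rgf c t x).
  rewrite subr_gt0.
  by have /andP[] : 0 <= rgf c t x < 1 by apply: rgf_itv => //; rewrite (le_trans s0 sc).
by move=> r rst; rewrite lerB// cmax.
Qed.

Lemma measurable_rgf (s t x : R) : 0 <= s <= t -> 0 <= x < 1 ->
  measurable_fun `[s, t] (fun r => rgf r t x).
Proof.
move=> st x01; apply: subspace_continuous_measurable_fun => //.
exact: rgf_within_continuous.
Qed.

Lemma measurable_Jq (s t x : R) : 0 <= s <= t -> 0 <= x < 1 ->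
  measurable_fun `[s, t] (fun r => Jq (q r) (alpha r) (rgf r t x)).
Proof.
move=> /[dup] st /andP[s0 _] x01.
apply: emeasurable_funD.
  apply/measurable_EFinP; apply: measurable_funM; first exact: measurable_q.
  apply: measurable_funM; first exact: measurable_rgf.
  apply: subspace_continuous_measurable_fun => //.
  rewrite continuous_subspace_in => r; rewrite inE/= in_itv/= => /andP[sr rt].
  apply: cvgV.
    rewrite subr_eq0 gt_eqF//.
    by have /andP[] : 0 <= rgf r t x < 1 by apply: rgf_itv => //;
      rewrite (le_trans s0 sr).
  apply: cvgB; first exact: cvg_cst.
  exact: (rgf_within_continuous st x01).
apply: ge0_emeasurable_sum => [k r|k _].
  rewrite /= in_itv/= => rst _; apply: geo_term_ge0.
    by move=> j; apply: alpha_ge0; have /andP[/(le_trans s0)] := rst.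
  have /andP[sr rt] := rst.
  by have /andP[] : 0 <= rgf r t x < 1 by apply: rgf_itv => //; rewrite (le_trans s0 sr).
apply/measurable_EFinP; apply: measurable_funM; first exact: measurable_alpha.
apply: (@measurableT_comp _ _ _ _ _ _ (geo k)); last exact: measurable_rgf.
by apply: continuous_measurable_fun; exact: continuous_geo.
Qed.

(** The evolution equation at a real point: the factor 1 - F of Phi(F) cancels in the logarithmic
    derivative. A second null set is discarded, off which the rates are summable and the [limn] in
    [herglotz] is a genuine limit. *)
Lemma is_derive_ln_rgf (s t x : R) : 0 <= s <= t -> 0 <= x < 1 ->
  {ae leb, forall r, r \in `]s, t[ ->
    is_derive r 1 (fun r => ln (1 - rgf r t x)) (alpha r 0%N - fine (Jq (q r) (alpha r)
      (rgf r t x)))}.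
Proof.
move=> /[dup] st /andP[s0 st'] /[dup] x01 /andP[x0 x1].
have t0 := le_trans s0 st'.
have zD : inD (x%:C)%C by apply/inD_real; rewrite ger0_norm.
have := rate_cvg st; have := avf t0 zD.
have FF := ae_filter_ringOfSetsType leb.
apply: filterS2 => r hr cr rst.
have /andP[sr rt] : s < r < t by move: rst; rewrite in_itv.
have r0 : 0 <= r by rewrite (le_trans s0)// ltW.
have rt0 : 0 <= r <= t by rewrite r0 ltW.
have [] := hr; first by rewrite in_itv/= rt0.
have -> : (fun r0 => complex.Re (pgfs ell r0 t (x%:C)%C)) = (fun r => rgf r t x).
  by apply/funext => u; rewrite pgfs_real.
move=> dr _ + _; rewrite pgfs_real.
have y01 := rgf_itv rt0 x01; have /andP[y0 y1] := y01.
rewrite -[complex.Re _]/(on_reals (herglotz q alpha ^~ r) (rgf r t x)) on_reals_herglotz.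
rewrite herglotz_Jq//; last 2 first.
- by move=> k; apply: offdiag_ge0 => j; exact: alpha_ge0.
- by apply: cr; rewrite in_itv/= !ltW.
rewrite Jq_offdiag /offdiag/= => dE.
have d1 : is_derive r 1 (fun r =>
  rgf r t x) ((1 - rgf r t x) * (fine (Jq (q r) (alpha r) (rgf r t x)) - alpha r 0%N)).
  by apply: DeriveDef => //; rewrite -derive1E.
have d2 : is_derive r 1 (fun r =>
  1 - rgf r t x) (0 - (1 - rgf r t x) * (fine (Jq (q r) (alpha r) (rgf r t x)) - alpha
    r 0%N)).
  exact: is_deriveB.
have d3 : is_derive (1 - rgf r t x) 1 (@ln R) (1 - rgf r t x)^-1
  by apply: is_derive1_ln; rewrite subr_gt0.
have d4 := @is_derive1_comp _ (@ln R) (fun r => 1 - rgf r t x) r _ _ d3 d2.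
apply: (is_derive_eq d4); move: (fine _) => J.
by field; rewrite subr_eq0 gt_eqF.
Qed.

Theorem integral_Jq (s t x : R) : 0 <= s <= t -> 0 <= x < 1 ->
  (\int[leb]_(r in `[s, t]) Jq (q r) (alpha r) (rgf r t x) =
   (ln (1 - rgf s t x) - ln (1 - x) + \int[leb]_(r in `[s, t]) alpha r 0%N)%:E)%E.
Proof.
move=> /[dup] st /andP[s0 st'] /[dup] x01 /andP[x0 x1].
move: st'; rewrite le_eqVlt => /predU1P[E|slt].
  rewrite -E set_itv1 integral_set1 Rintegral_set1 rgf_id ?subrr ?addr0// .
have [d d0 db] := rgf_sup st x01.
have [g ig gb] := rgf_dominated.
have igst : leb.-integrable `[s, t] (EFin \o g).
  apply: integrableS (ig t (le_trans s0 (ltW slt))) => //.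
  by apply: subset_itvr; rewrite bnd_simp.
have mJ := measurable_Jq st x01.
have mh : measurable_fun `[s, t] (fun r =>
  alpha r 0%N - fine (Jq (q r) (alpha r) (rgf r t x))).
  apply: measurable_funB; first exact: measurable_alpha.
  exact: measurableT_comp mJ.
have idg : leb.-integrable `[s, t] (EFin \o (fun r => d^-1 * g r)).
  by apply: (eq_integrable _ _ _ _ (integrableZl _ d^-1 igst)).
have dom u v : s <= u -> u <= v -> v <= t ->
    `|ln (1 - rgf v t x) - ln (1 - rgf u t x)| <= \int[leb]_(r in `[u, v]) (d^-1 * g r).
  move=> su uv vt.
  have -> : \int[leb]_(r in `[u, v]) (d^-1 * g r) = d^-1 * \int[leb]_(r in `[u, v]) g r.
    rewrite RintegralZl//; apply: integrableS igst => //.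
    by apply: subset_itv; rewrite bnd_simp.
  rewrite (le_trans (ln_lipschitz d0 (db _ _) (db _ _)))//.
  - by rewrite (le_trans su uv).
  - by rewrite su (le_trans uv).
  rewrite ler_wpM2l ?invr_ge0 ?(ltW d0)//.
  rewrite opprB addrC subrKA distrC.
  by apply: gb => //; exact: le_trans su.
have [ih] := dominated_ftc slt idg dom mh (is_derive_ln_rgf st x01).
rewrite rgf_id ?(le_trans s0 (ltW slt))// => hE.
have ia := alpha0_integrable st.
have iJ : leb.-integrable `[s, t] (EFin \o (fun r =>
  fine (Jq (q r) (alpha r) (rgf r t x)))).
  apply: (eq_integrable _ _ _ _ (integrableB _ ia ih)) => //= r _.
  by rewrite -EFinB; congr EFin; ring.
have E : \int[leb]_(r in `[s, t]) fine (Jq (q r) (alpha r) (rgf r t x)) =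
    ln (1 - rgf s t x) - ln (1 - x) + \int[leb]_(r in `[s, t]) alpha r 0%N.
  have := hE; rewrite RintegralB// => /eqP; rewrite subr_eq => /eqP ->.
  by ring.
rewrite -E /Rintegral fineK; last exact: integrable_fin_num.
(* [Jq] is known to agree with its [fine] part only where the rates are summable, that is, almost
   everywhere. *)
apply: ae_eq_integral => //; first by apply/measurable_EFinP; exact: measurableT_comp mJ.
have := rate_cvg st; apply: filterS; first exact: (ae_filter_ringOfSetsType leb).
move=> r cr rst.
have /andP[sr rt] : s <= r <= t by move: rst; rewrite /= in_itv.
have r0 : 0 <= r by rewrite (le_trans s0).
have rt0 : 0 <= r <= t by rewrite r0.
rewrite -Jq_offdiag Jq_EFin//.
- by move=> k; apply: offdiag_ge0 => j; exact: alpha_ge0.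
- exact: cr.
- exact: rgf_itv.
Qed.

End evolution_family.

(** * Limits at 1 *)

Section left_sequences.
Context {R : realType}.

Lemma cvg_seq_at_left (u : R^nat) (p : R) : (forall n, u n < p) ->
  u @ \oo --> p -> u @ \oo --> p^'-.
Proof.
move=> ul /cvgrPdist_lt up A [e /= e0 eA]; have := up e e0.
by apply: filterS => n /= pn; apply: eA => //=; rewrite distrC.
Qed.

(** Monotone convergence of integrals is stated for sequences, so limits at 1 from the left are
    taken along this nondecreasing one. *)
Definition approx1 (n : nat) : R := 1 - n.+1%:R^-1.

Lemma approx1_itv n : 0 <= approx1 n < 1.
Proof. by rewrite /approx1 subr_ge0 invf_le1// ler1n/= ltrBlDr ltrDl. Qed.

Lemma approx1_homo : {homo approx1 : m n / (m <= n)%N >-> m <= n}.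
Proof. by move=> m n mn; rewrite /approx1 lerB// lef_pV2 ?posrE// ler_nat. Qed.

Lemma cvg_approx1 : approx1 @ \oo --> 1^'-.
Proof.
apply: cvg_seq_at_left; first by move=> n; have /andP[] := approx1_itv n.
rewrite -[X in _ --> X]subr0; apply: cvgB; [exact: cvg_cst|exact: cvg_harmonic].
Qed.

End left_sequences.

(** * The mean as the limit of secant slopes at 1 *)

Section prob_mean.
Context {R : realType} (mu : N0s -> R).
Hypothesis pmu : is_prob mu.
Let p k := mu (Some k).

Definition N0s_mean : \bar R := ((mu None)%:E * +oo + \sum_(k <oo) (k%:R * p k)%:E)%E.

Lemma N0s_mean_fin : (N0s_mean < +oo)%E ->
  mu None = 0 /\ N0s_mean = (\sum_(k <oo) (k%:R * p k)%:E)%E.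
Proof.
have S0 : (0 <= \sum_(k <oo) (k%:R * p k)%:E)%E.
  by apply: nneseries_ge0 => k _ _; rewrite lee_fin mulr_ge0//; exact: (is_prob_ge0 pmu).
rewrite /N0s_mean; have [/(_ None)] := pmu; rewrite le_eqVlt => /predU1P[<- _|m0 _].
  by rewrite mul0e add0e.
rewrite gt0_muley ?lte_fin//.
by case: (\sum_(k <oo) _)%E S0.
Qed.

Lemma at1_gf : at1 (gf p) = (1 - mu None)%:E.
Proof.
rewrite -(is_prob_lim pmu) EFin_limn_series; last exact: (is_prob_cvg pmu).
apply/cvg_lim => //; apply: gf_left1; last exact: (is_prob_cvg pmu).
exact: (is_prob_ge0 pmu).
Qed.

Lemma at1_derive_gf : at1 (derive1 (gf p)) = (\sum_(k <oo) (k%:R * p k)%:E)%E.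
Proof.
apply/cvg_lim => //; apply: derive_gf_left1; last exact: (is_prob_cvg pmu).
exact: (is_prob_ge0 pmu).
Qed.

Lemma N0s_mean_lty : (N0s_mean < +oo)%E <->
  at1 (gf p) = 1%:E /\ (at1 (derive1 (gf p)) < +oo)%E.
Proof.
rewrite at1_gf at1_derive_gf; split.
  by move=> /[dup] h /N0s_mean_fin[-> <-]; rewrite subr0.
move=> [[] /eqP]; rewrite subr_eq addrC -subr_eq subrr => /eqP E.
by rewrite /N0s_mean -E mul0e add0e.
Qed.

Let S0 : (0 <= \sum_(k <oo) (p k * k.-1%:R)%:E)%E.
Proof. by apply: nneseries_ge0 => k _ _; rewrite lee_fin mulr_ge0//;
  exact: (is_prob_ge0 pmu). Qed.

(** By [gf_Jq] the slope is [Jq] plus 1 - p_0, so [Jq_cvg_left1] gives the limit. It equals the mean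
    also with mass at oo, both sides then being [+oo]. *)
Lemma gf_secant_cvg : ((1 - gf p x) / (1 - x))%:E @[x --> 1^'-] --> N0s_mean.
Proof.
have p0 := is_prob_ge0 pmu; have cp := is_prob_cvg pmu.
have [/(_ None) m0 _] := pmu.
have -> : (N0s_mean = (mu None)%:E * +oo + \sum_(k <oo) (p k * k.-1%:R)%:E + (1 - p
  0%N)%:E)%E.
  rewrite /N0s_mean nneseries_mean// (is_prob_lim pmu) addeA.
  move: m0; rewrite le_eqVlt => /predU1P[<-|m0]; first by rewrite subr0.
  by rewrite gt0_muley ?lte_fin//; case: (\sum_(k <oo) _)%E S0.
have : (Jq (mu None) p x + (1 - p 0%N)%:E)%E @[x --> 1^'-] -->
    ((mu None)%:E * +oo + \sum_(k <oo) (p k * k.-1%:R)%:E + (1 - p 0%N)%:E)%E.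
  by apply: cvgeD; [rewrite fin_num_adde_defl|exact: Jq_cvg_left1|exact: cvg_cst].
apply: cvg_trans; apply: near_eq_cvg; apply: filterS near_left1 => x /andP[x0 x1].
have x01 : 0 <= x < 1 by rewrite ltW.
have Jfin : Jq (mu None) p x \is a fin_num by rewrite Jq_EFin.
rewrite (gf_Jq pmu x01) -[X in (X + _)%E](fineK Jfin) -EFinD; congr EFin.
by rewrite [(1 - x) * _]mulrC mulfK ?subr_eq0 ?gt_eqF// addrA.
Qed.

Lemma gf_secant_homo x y : 0 <= x -> x <= y -> y < 1 ->
  (1 - gf p x) / (1 - x) <= (1 - gf p y) / (1 - y).
Proof.
move=> x0 xy y1; have p0 := is_prob_ge0 pmu; have cp := is_prob_cvg pmu.
have [/(_ None) m0 _] := pmu; have x1 := le_lt_trans xy y1.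
have x01 : 0 <= x < 1 by rewrite x0.
have y01 : 0 <= y < 1 by rewrite (le_trans x0).
rewrite (gf_Jq pmu x01) (gf_Jq pmu y01) ![(1 - _) * _]mulrC !mulfK ?subr_eq0 ?gt_eqF//.
rewrite !lerD2r; have := Jq_homo m0 p0 x0 xy y1.
by rewrite Jq_EFin// Jq_EFin.
Qed.

Lemma gf_secant_le x : 0 <= x < 1 -> (((1 - gf p x) / (1 - x))%:E <= N0s_mean)%E.
Proof.
move=> /andP[x0 x1]; apply: cvge_to_ge gf_secant_cvg _.
near=> y; rewrite lee_fin; by apply: gf_secant_homo => //; near: y; exact: nbhs_left_ge.
Unshelve. all: by end_near. Qed.

End prob_mean.

(** * Finite means *)

Section mean_evolution.
Context {R : realType}.
Local Notation leb := (@lebesgue_measure R).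
Variable ell : R -> R -> N0s -> N0s -> R.
Variables (q : R -> R) (alpha : R -> nat -> R).
Hypothesis bk : branching_kernels ell.
Hypothesis fam : abs_cont_rev_evol_family (pgfs ell).
Hypothesis gen : generating_family q alpha.
Hypothesis avf : associated_vector_field (pgfs ell) (herglotz q alpha).

Local Notation explosion s t := (ell s t (Some 1%N) None).
Local Notation mean s t := (N0s_mean (ell s t (Some 1%N))).

Let pr (s t : R) : 0 <= s <= t -> is_prob (ell s t (Some 1%N)).
Proof. exact: is_prob_ell. Qed.

Lemma rgf_le s t x : 0 <= s <= t -> 0 <= x < 1 -> rgf ell s t x <= 1 - explosion s t.
Proof.
move=> st /andP[x0 x1]; rewrite -(is_prob_lim (pr st)).
rewrite -[X in limn X]pseries1; apply: gf_homo => //; last exact: ltW.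
  exact: (is_prob_ge0 (pr st)).
exact: (is_prob_cvg (pr st)).
Qed.

(* If F_{r,t}(1) = c < 1, then F_{0,t} <= F_{0,r}(c) < 1. *)
Lemma no_explosion r t : 0 <= r <= t -> explosion 0 t = 0 -> explosion r t = 0.
Proof.
move=> /andP[r0 rt] e0.
have rt0 : 0 <= r <= t by rewrite r0.
have t0 : (0 : R) <= 0 <= t by rewrite lexx (le_trans r0).
have or0 : (0 : R) <= 0 <= r by rewrite lexx r0.
have [/(_ None)] := pr rt0; rewrite le_eqVlt => /predU1P[<-//|er] _.
set c := 1 - explosion r t.
have c01 : 0 <= c < 1.
  rewrite ltrBlDr ltrDl er andbT (le_trans _ (@rgf_le r t 0 rt0 _)) ?lexx ?ltr01//.
  by have /andP[] : 0 <= rgf ell r t 0 < 1 by apply: rgf_itv; rewrite ?lexx ?ltr01.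
have /andP[c0 c1] := c01.
have /andP[_ c'1] := rgf_itv bk fam or0 c01.
suff : 1 <= rgf ell 0 r c by rewrite leNgt c'1.
have := gf_left1 (is_prob_ge0 (pr t0)) (is_prob_cvg (pr t0)).
rewrite -EFin_limn_series; last exact: (is_prob_cvg (pr t0)).
rewrite (is_prob_lim (pr t0)) e0 subr0 -lee_fin => h.
apply: cvge_to_le h _; apply: filterS near_left1 => x /andP[x0 x1].
have x01 : 0 <= x < 1 by rewrite ltW.
rewrite lee_fin -[X in X <= _]/(rgf ell 0 t x) (rgf_comp fam or0 rt x01).
have /andP[y0 _] := rgf_itv bk fam rt0 x01.
by apply: rgf_homo => //; exact: rgf_le.
Qed.

Lemma cvg_rgf1 r t : 0 <= r <= t -> explosion r t = 0 ->
  rgf ell r t (approx1 n) @[n --> \oo] --> 1^'-.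
Proof.
move=> rt e0; apply: cvg_seq_at_left.
  by move=> n; have /andP[] := rgf_itv bk fam rt (approx1_itv n).
have := gf_left1 (is_prob_ge0 (pr rt)) (is_prob_cvg (pr rt)).
rewrite -EFin_limn_series; last exact: (is_prob_cvg (pr rt)).
rewrite (is_prob_lim (pr rt)) e0 subr0 => h.
by have /fine_cvgP[_] := cvg_comp _ _ cvg_approx1 h.
Qed.

(** The weight is (k - 1)^+, by truncated predecessor. Where the rates are summable, Phi'(1, r) =
    q_r + alpha_r(0) - [excess r]. *)
Definition excess r : \bar R := (\sum_(k <oo) (alpha r k * k.-1%:R)%:E)%E.

Lemma excess_ge0 r : 0 <= r -> (0 <= excess r)%E.
Proof.
by move=> r0; apply: nneseries_ge0 => k _ _; rewrite lee_fin mulr_ge0// (alpha_ge0 gen).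
Qed.

Lemma measurable_excess (s t : R) : 0 <= s -> measurable_fun `[s, t] excess.
Proof.
move=> s0; apply: ge0_emeasurable_sum => [k r|k _].
  rewrite /= in_itv/= => /andP[sr _] _; rewrite lee_fin mulr_ge0// (alpha_ge0 gen)//.
  exact: le_trans sr.
apply/measurable_EFinP; apply: measurable_funM; last exact: measurable_cst.
exact: (measurable_alpha gen).
Qed.

Lemma integral_Jq_secant (s t x : R) : 0 <= s <= t -> 0 <= x < 1 ->
  (\int[leb]_(r in `[s, t]) Jq (q r) (alpha r) (rgf ell r t x) =
   (ln ((1 - rgf ell s t x) / (1 - x)) + \int[leb]_(r in `[s, t]) alpha r 0%N)%:E)%E.
Proof.
move=> st x01; rewrite (integral_Jq bk fam gen avf)// ln_div// posrE subr_gt0.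
  by have /andP[] := rgf_itv bk fam st x01.
by have /andP[] := x01.
Qed.

Lemma cvg_integral_Jq (s t : R) : 0 <= s <= t ->
  (forall r, s <= r <= t -> explosion r t = 0) ->
  (\int[leb]_(r in `[s, t]) Jq (q r) (alpha r) (rgf ell r t (approx1 n)))%E @[n -->
    \oo] -->
  (\int[leb]_(r in `[s, t]) ((q r)%:E * +oo + excess r))%E.
Proof.
move=> /[dup] st /andP[s0 _] e0.
have D r : `[s, t]%classic r -> [/\ s <= r <= t, 0 <= r <= t & 0 <= r].
  by rewrite /= in_itv/= => /andP[sr rt]; rewrite sr rt (le_trans s0 sr).
have <- : (\int[leb]_(r in `[s, t]) limn (fun n =>
  Jq (q r) (alpha r) (rgf ell r t (approx1 n))) =
    \int[leb]_(r in `[s, t]) ((q r)%:E * +oo + excess r))%E.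
  apply: eq_integral => r /set_mem /D[srt rt r0]; apply/cvg_lim => //.
  apply: (cvg_comp _ _ (cvg_rgf1 rt (e0 _ srt))).
  by apply: Jq_cvg_left1 => [|k]; [exact: (q_ge0 gen)|exact: (alpha_ge0 gen)].
apply: (@cvg_monotone_convergence _ _ _ leb `[s, t] _
  (fun n r => Jq (q r) (alpha r) (rgf ell r t (approx1 n)))) => //.
- by move=> n; apply: (measurable_Jq bk fam gen) => //; exact: approx1_itv.
- move=> n r /D[_ rt r0]; apply: Jq_ge0.
  + exact: (q_ge0 gen).
  + by move=> k; exact: (alpha_ge0 gen).
  + by apply: rgf_itv => //; exact: approx1_itv.
- move=> r /D[_ rt r0] m n mn.
  have /andP[am0 am1] := @approx1_itv R m; have /andP[an0 an1] := @approx1_itv R n.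
  have /andP[b0 _] := rgf_itv bk fam rt (approx1_itv m).
  have /andP[_ b1] := rgf_itv bk fam rt (approx1_itv n).
  apply: Jq_homo => //.
  + exact: (q_ge0 gen).
  + by move=> k; exact: (alpha_ge0 gen).
  + by apply: (rgf_homo bk) => //; exact: approx1_homo.
Qed.

Lemma secant_gt0 (s t x : R) : 0 <= s <= t -> 0 <= x < 1 ->
  0 < (1 - rgf ell s t x) / (1 - x).
Proof.
move=> st /[dup] x01 /andP[_ x1]; rewrite divr_gt0 ?subr_gt0//.
by have /andP[] := rgf_itv bk fam st x01.
Qed.

(** Secant slopes stay below the mean, so the identity bounds all the approximating integrals by the
    logarithm of the mean plus a constant. *)
Lemma integral_limit_lty (t : R) : 0 <= t -> (mean 0%R t < +oo)%E ->
  (\int[leb]_(r in `[0%R, t]) ((q r)%:E * +oo + excess r) < +oo)%E.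
Proof.
move=> t0 mt; have t00 : (0 : R) <= 0 <= t by rewrite lexx.
have [e0 _] := N0s_mean_fin (pr t00) mt.
have m0 : (0 <= mean 0%R t)%E.
  apply: le_trans (gf_secant_le (pr t00) (approx1_itv 0)); rewrite lee_fin.
  exact: ltW (secant_gt0 t00 (approx1_itv 0)).
have mfin : mean 0%R t \is a fin_num by rewrite ge0_fin_numE.
apply: (@le_lt_trans _ _ (ln (fine (mean 0%R t)) + \int[leb]_(r in `[0,
  t]) alpha r 0%N)%:E); last by rewrite ltry.
apply: cvge_to_le (cvg_integral_Jq t00 _) _.
  by move=> r rt; apply: no_explosion.
apply: nearW => n; rewrite integral_Jq_secant// ?approx1_itv// lee_fin lerD2r.
have h1 := gf_secant_le (pr t00) (approx1_itv n).
have h2 := secant_gt0 t00 (approx1_itv n).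
have h3 : (1 - rgf ell 0 t (approx1 n)) / (1 - approx1 n) <= fine (mean 0%R t).
  by rewrite -lee_fin fineK.
by rewrite ler_ln ?posrE// (lt_le_trans h2).
Qed.

(** An integrable function is finite almost everywhere, and [(q r)%:E * +oo] is finite only for q_r
    = 0. *)
Lemma limit_rates (t : R) : 0 <= t -> (mean 0%R t < +oo)%E ->
  {ae leb, forall r, r \in `[0, t] -> q r = 0} /\ leb.-integrable `[0, t] excess.
Proof.
move=> t0 mt; have t00 : (0 : R) <= 0 <= t by rewrite lexx.
have D r : `[0, t]%classic r -> 0 <= r by rewrite /= in_itv/= => /andP[].
have q0 r : `[0, t]%classic r -> (0 <= (q r)%:E * +oo)%E.
  by move=> /D r0; rewrite mule_ge0// lee_fin (q_ge0 gen).
have mq : measurable_fun `[0, t] (fun r => (q r)%:E * +oo)%E.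
  apply: emeasurable_funM; last exact: measurable_cst.
  by apply/measurable_EFinP; exact: (measurable_q gen).
have mJ : measurable_fun `[0, t] (fun r => (q r)%:E * +oo + excess r)%E.
  by apply: emeasurable_funD => //; exact: measurable_excess.
have iJ : leb.-integrable `[0, t] (fun r => (q r)%:E * +oo + excess r)%E.
  apply/integrableP; split => //.
  apply: le_lt_trans (integral_limit_lty t0 mt); rewrite le_eqVlt; apply/orP; left;
    apply/eqP.
  by apply: eq_integral => r /set_mem Dr;
    rewrite gee0_abs// adde_ge0 ?q0// excess_ge0//; exact: D.
split; last first.
  apply: le_integrable iJ => //; first exact: measurable_excess.
  move=> r Dr; rewrite !gee0_abs ?adde_ge0 ?q0 ?excess_ge0 ?(D _ Dr)//.
  by rewrite leeDr// q0.
have : {ae leb, forall r, `[0, t]%classic r ->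
  ((q r)%:E * +oo + excess r)%E \is a fin_num}.
  by apply: integrable_ae.
apply: filterS; first exact: (ae_filter_ringOfSetsType leb).
move=> r h rt; have := h rt; have r0 := D r rt.
have := q_ge0 gen r0; rewrite le_eqVlt => /predU1P[<-//|qr].
by rewrite gt0_muley ?lte_fin//; case: (excess r) (excess_ge0 r0).
Qed.

Section finite_rates.
Hypothesis q0 : {ae leb, forall t, 0 <= t -> q t = 0}.
Hypothesis iexcess : forall T, 0 <= T -> leb.-integrable `[0, T] excess.

Lemma excess_integrable (s t : R) : 0 <= s <= t -> leb.-integrable `[s, t] excess.
Proof.
move=> /andP[s0 st]; apply: integrableS (iexcess (le_trans s0 st)) => //.
by apply: subset_itvr; rewrite bnd_simp.
Qed.

Let A (s t : R) := \int[leb]_(r in `[s, t]) alpha r 0%N.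
Let M (s t : R) := fine (\int[leb]_(r in `[s, t]) excess r)%E.

Let ME (s t : R) : 0 <= s <= t -> (\int[leb]_(r in `[s, t]) excess r)%E = (M s t)%:E.
Proof. by move=> st; rewrite fineK//; apply: integrable_fin_num => //;
  exact: excess_integrable. Qed.

(** Explosion is not yet excluded, so F_{r,t}(x) need not tend to 1. The bound [geo k y] <= k - 1
    for k >= 1 suffices: with q = 0 it gives J <= [excess], hence secant slopes of at most exp(M -
    A). *)
Lemma mean_lty (s t : R) : 0 <= s <= t -> (mean s t < +oo)%E.
Proof.
move=> /[dup] st /andP[s0 _].
suff : (mean s t <= (expR (M s t - A s t))%:E)%E by move=> /le_lt_trans; apply;
  rewrite ltry.
have h := cvg_comp _ _ cvg_approx1 (gf_secant_cvg (pr st)).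
apply: cvge_to_le h _; apply: nearW => n /=.
have x01 := @approx1_itv R n.
have d0 := secant_gt0 st x01.
rewrite lee_fin -ler_ln ?posrE ?expR_gt0// expRK lerBrDr -lee_fin.
have := integral_Jq_secant st x01; rewrite -/(A s t) => <-.
rewrite -ME//; apply: ae_ge0_le_integral => //.
- move=> r /=; rewrite in_itv/= => /andP[sr rt]; apply: Jq_ge0.
  + by apply: (q_ge0 gen); exact: le_trans sr.
  + by move=> k; apply: (alpha_ge0 gen); exact: le_trans sr.
  + by apply: rgf_itv => //; rewrite (le_trans s0 sr).
- exact: (measurable_Jq bk fam gen).
- by move=> r /=; rewrite in_itv/= => /andP[sr rt]; apply: excess_ge0; exact: le_trans sr.
- exact: measurable_excess.
have := q0; apply: filterS; first exact: (ae_filter_ringOfSetsType leb).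
move=> r qr rst; have /andP[sr rt] : s <= r <= t by move: rst; rewrite /= in_itv.
have r0 := le_trans s0 sr.
rewrite /Jq qr// mul0r add0e; have rt0 : 0 <= r <= t by rewrite r0.
have /andP[y0 y1] := rgf_itv bk fam rt0 x01.
apply: lee_nneseries => [k _ _|k _].
  by apply: geo_term_ge0 => // j; exact: (alpha_ge0 gen).
rewrite lee_fin ler_wpM2l ?(alpha_ge0 gen)// -geo_at1.
by apply: geo_homo; rewrite ?in_itv/= ?y0 ?ler01 ?lexx ?(ltW y1).
Qed.

(** The finite means from [mean_lty] exclude explosion. The secant slopes along [approx1] then have
    two limits: the mean, and exp(M - A) by monotone convergence. *)
Lemma mean_expR (s t : R) : 0 <= s <= t -> mean s t = (expR (M s t - A s t))%:E.
Proof.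
move=> /[dup] st /andP[s0 _].
have e0 r : s <= r <= t -> explosion r t = 0.
  move=> /andP[sr rt]; have rt0 : 0 <= r <= t by rewrite (le_trans s0 sr).
  by have [] := N0s_mean_fin (pr rt0) (mean_lty rt0).
have h := cvg_comp _ _ cvg_approx1 (gf_secant_cvg (pr st)).
have := cvg_integral_Jq st e0.
have -> : (\int[leb]_(r in `[s, t]) ((q r)%:E * +oo + excess r) = (M s t)%:E)%E.
  rewrite -ME//; apply: ae_eq_integral => //.
  - apply: emeasurable_funD; last exact: measurable_excess.
    apply: emeasurable_funM; last exact: measurable_cst.
    by apply/measurable_EFinP; exact: (measurable_q gen).
  - exact: measurable_excess.
  have := q0; apply: filterS; first exact: (ae_filter_ringOfSetsType leb).
  move=> r qr /=; rewrite ?in_itv/= => /andP[sr rt]; rewrite qr ?(le_trans s0)//.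
  by rewrite mul0e add0e.
under eq_fun do rewrite integral_Jq_secant ?approx1_itv//.
move=> /fine_cvgP[_] /= hl.
have {}hl : (fun n => ln ((1 - rgf ell s t (approx1 n)) / (1 - approx1 n))) @ \oo --> M
  s t - A s t.
  rewrite (_ : (fun n => _) = (fun n =>
    ln ((1 - rgf ell s t (approx1 n)) / (1 - approx1 n)) + A s t - A s t)).
    by apply: cvgB; [exact: hl|exact: cvg_cst].
  by apply/funext => n; rewrite addrK.
have he : (fun n => (1 - rgf ell s t (approx1 n)) / (1 - approx1 n)) @ \oo --> expR (M
  s t - A s t).
  rewrite (_ : (fun n => _) = (fun n =>
    expR (ln ((1 - rgf ell s t (approx1 n)) / (1 - approx1 n))))).
    by apply: (cvg_comp _ _ hl); exact: continuous_expR.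
  by apply/funext => n; rewrite lnK// posrE secant_gt0// approx1_itv.
have := cvg_unique _ h (_ : _ --> (expR (M s t - A s t))%:E); apply => //.
by apply: cvg_EFin; [exact: nearW|exact: he].
Qed.

End finite_rates.
End mean_evolution.

(** * The vector field and its derivative at 1 in terms of the rates *)

Section boundary_rates.
Context {R : realType}.
Local Notation leb := (@lebesgue_measure R).
Variables (q : R -> R) (alpha : R -> nat -> R).
Hypothesis gen : generating_family q alpha.

Local Notation phi1 t := (at1 (on_reals (herglotz q alpha ^~ t))).
Local Notation dphi1 t := (at1 (derive1 (on_reals (herglotz q alpha ^~ t)))).
Local Notation weighted t := (\sum_(n <oo | n != 1%N) ((n.+1)%:R * alpha t n)%:E)%E.
Local Notation rate t := (\sum_(n <oo) (offdiag (alpha t) n)%:E)%E.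

Let o_ge0 t k : 0 <= t -> 0 <= offdiag (alpha t) k.
Proof. by move=> t0; apply: offdiag_ge0 => j; exact: (alpha_ge0 gen). Qed.

Lemma on_reals_herglotzE t : on_reals (herglotz q alpha ^~ t) =
  fun x => q t * x + limn (series (fun n => offdiag (alpha t) n * (x - x ^+ n))).
Proof. by apply/funext => x; exact: on_reals_herglotz. Qed.

Lemma phi1E t : 0 <= t -> cvgn (series (offdiag (alpha t))) -> phi1 t = (q t)%:E.
Proof.
move=> t0 ca; rewrite on_reals_herglotzE; apply/cvg_lim => //.
by apply: herglotz_left1 => // k; exact: o_ge0.
Qed.

Lemma dphi1E t : 0 <= t -> cvgn (series (offdiag (alpha t))) ->
  dphi1 t = ((q t + alpha t 0%N)%:E - excess alpha t)%E.
Proof.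
move=> t0 ca; rewrite on_reals_herglotzE; apply/cvg_lim => //.
have -> : (excess alpha t = \sum_(k <oo) (offdiag (alpha t) k * k.-1%:R)%:E)%E.
  by apply: eq_eseriesr => k _; rewrite -geo_at1 offdiag_geo.
by apply: derive_herglotz_left1 => // k; exact: o_ge0.
Qed.

Lemma dphi1_dvg t : 0 <= t -> ~ cvgn (series (offdiag (alpha t))) -> dphi1 t = (q t)%:E.
Proof.
move=> t0 ca; rewrite on_reals_herglotzE; apply/cvg_lim => //.
by apply: derive_herglotz_left1_dvg => // k; exact: o_ge0.
Qed.

Lemma ae_rate_cvg : {ae leb, forall t, 0 <= t -> cvgn (series (offdiag (alpha t)))}.
Proof.
have FF := ae_filter_ringOfSetsType leb.
(* The half-line is a countable union of the intervals [0, n]. *)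
have : {ae leb, forall t, forall n : nat, t \in `[0, n%:R] ->
  cvgn (series (offdiag (alpha t)))}.
  by apply/ae_foralln => n; apply: (rate_cvg gen); rewrite lexx ler0n.
apply: filterS => t h t0; apply: (h (Num.bound t)).
by rewrite in_itv/= t0 ltW// archi_boundP.
Qed.

Lemma ae_phi1_eq0 : {ae leb, forall t, 0 <= t -> phi1 t = 0%:E} <->
  {ae leb, forall t, 0 <= t -> q t = 0}.
Proof.
have FF := ae_filter_ringOfSetsType leb; have cr := ae_rate_cvg.
split; move: cr; apply: filterS2 => t ct ht t0; have := ht t0; rewrite (phi1E t0 (ct t0)).
  by move=> -[].
by move=> ->.
Qed.

Lemma weightedE t : 0 <= t -> weighted t = (\sum_(n <oo) (n.+1%:R * offdiag (alpha t)
  n)%:E)%E.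
Proof. by move=> t0; apply: nneseries_offdiag => // k; exact: (alpha_ge0 gen). Qed.

Lemma measurable_offdiag (s t : R) n : 0 <= s -> measurable_fun `[s, t] (fun r =>
  offdiag (alpha r) n).
Proof.
move=> s0; rewrite /offdiag; case: eqP => _; first exact: measurable_cst.
exact: (measurable_alpha gen).
Qed.

Let in0 (T r : R) : `[0, T]%classic r -> 0 <= r.
Proof. by rewrite /= in_itv/= => /andP[]. Qed.

(** The weights satisfy (k - 1)^+ <= k + 1 <= 3 (k - 1)^+ + 3, and the total rate is locally
    integrable by hypothesis. *)
Lemma L1loc_weighted : L1loc (fun t => weighted t) <-> L1loc (excess alpha).
Proof.
have wge0 r : 0 <= r -> (0 <= weighted r)%E.
  by move=> r0; apply: nneseries_ge0 => k _ _; rewrite lee_fin mulr_ge0// (alpha_ge0 gen).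
split=> h T T0; have hT := h T T0.
  apply: le_integrable hT => //; first exact: (measurable_excess gen).
  move=> r /in0 r0; rewrite !gee0_abs ?wge0 ?(excess_ge0 gen)//.
  rewrite weightedE//; apply: lee_nneseries => [k _ _|k _].
    by rewrite lee_fin mulr_ge0// (alpha_ge0 gen).
  rewrite lee_fin -geo_at1 -offdiag_geo geo_at1 mulrC ler_wpM2r ?o_ge0//.
  by rewrite ler_nat (leq_trans (leq_pred _)).
have T00 : (0 : R) <= 0 <= T by rewrite lexx.
have i1 : leb.-integrable `[0, T] (fun r => 3%:E * excess alpha r)%E.
  by apply: integrableZl.
have i2 : leb.-integrable `[0, T] (fun r => 3%:E * rate r)%E.
  by apply: integrableZl => //; exact: (rate_integrable gen).
have iK : leb.-integrable `[0, T] (fun r => 3%:E * excess alpha r + 3%:E * rate r)%E.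
  exact: integrableD.
apply: le_integrable iK => //.
  apply: (@eq_measurable_fun _ _ _ _ _ (fun r =>
    \sum_(n <oo) (n.+1%:R * offdiag (alpha r) n)%:E)%E).
    by move=> r /set_mem /in0 r0; rewrite weightedE.
  apply: ge0_emeasurable_sum => [k r /in0 r0 _|k _].
    by rewrite lee_fin mulr_ge0// o_ge0.
  apply/measurable_EFinP; apply: measurable_funM; first exact: measurable_cst.
  exact: measurable_offdiag.
move=> r /in0 r0.
have rate0 : (0 <= rate r)%E by apply: nneseries_ge0 => k _ _; rewrite lee_fin o_ge0.
rewrite gee0_abs ?wge0// gee0_abs; last first.
  by rewrite adde_ge0// mule_ge0// ?lee_fin// (excess_ge0 gen).
rewrite weightedE// /excess -!nneseriesZl; last 2 first.
- by move=> k _; rewrite lee_fin o_ge0.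
- by move=> k _; rewrite lee_fin mulr_ge0// (alpha_ge0 gen).
rewrite -nneseriesD; last 2 first.
- by move=> k _ _; rewrite -EFinM lee_fin !mulr_ge0// (alpha_ge0 gen).
- by move=> k _ _; rewrite -EFinM lee_fin mulr_ge0// o_ge0.
apply: lee_nneseries => [k _ _|k _]; first by rewrite lee_fin mulr_ge0// o_ge0.
rewrite -!EFinM -EFinD lee_fin -geo_at1 -offdiag_geo geo_at1.
rewrite mulrA [3 * _]mulrC -mulrA -mulrDr mulrC ler_wpM2l ?o_ge0//.
case: k => [|k] /=; first by rewrite mulr0 add0r ler_nat.
have -> : (3 : R) = 3%:R by [].
by rewrite -natrM -natrD ler_nat; lia.
Qed.

(** Integrability includes measurability on the whole interval, so the null set of divergent rates
    cannot be discarded. There the default value of [limn] leaves the derivative q, and the two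
    formulas are glued along a measurable set. *)
Lemma measurable_dphi1 (T : R) : 0 <= T -> measurable_fun `[0, T] (fun t => dphi1 t).
Proof.
move=> T0; have T00 : (0 : R) <= 0 <= T by rewrite lexx.
have mB : measurable_fun `[0, T] (fun r => rate r).
  exact: measurable_int (rate_integrable gen T00).
pose E := `[0, T] `&` [set r | rate r \is a fin_num].
have mE : measurable E by exact: emeasurable_fin_num.
have mE' : measurable (`[0, T] `\` E) by apply: measurableD.
have DE : `[0, T]%classic = E `|` (`[0, T] `\` E) by rewrite setDUK//; exact: subIsetl.
have rate0 r : 0 <= r -> (0 <= rate r)%E.
  by move=> r0; apply: nneseries_ge0 => k _ _; rewrite lee_fin o_ge0.
have mq : measurable_fun `[0, T] q by exact: (measurable_q gen).
rewrite DE; apply/measurable_funU => //; split.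
  apply: (@eq_measurable_fun _ _ _ _ _ (fun t =>
    (q t + alpha t 0%N)%:E - excess alpha t)%E).
    move=> r /set_mem[/in0 r0 /=]; rewrite ge0_fin_numE ?rate0// => /nneseries_EFinP ca.
    by rewrite dphi1E//; apply: ca => k; exact: o_ge0.
  apply: (measurable_funS (measurable_itv `[0, T])); first exact: subIsetl.
  apply: emeasurable_funB; last exact: (measurable_excess gen).
  by apply/measurable_EFinP; apply: measurable_funD => //; exact: (measurable_alpha gen).
apply: (@eq_measurable_fun _ _ _ _ _ (fun t => (q t)%:E)).
  move=> r /set_mem[/[dup] Dr /in0 r0 nE]; rewrite dphi1_dvg// => ca; apply: nE;
    split => //=.
  by rewrite ge0_fin_numE ?rate0//; apply/nneseries_EFinP => // k; exact: o_ge0.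
apply: (measurable_funS (measurable_itv `[0, T])); first exact: subDsetl.
exact/measurable_EFinP.
Qed.

(** As q and alpha(0) are locally integrable and Phi'(1) = q + alpha(0) - [excess] almost
    everywhere, this dominates [excess] when f is Phi'(1), and Phi'(1) when f is [excess]. *)
Let majorant (f : R -> \bar R) r : \bar R :=
  (`|(q r)%:E| + `|(alpha r 0%N)%:E| + `|f r|)%E.

Let majorant_integrable (f : R -> \bar R) (T : R) : 0 <= T -> leb.-integrable `[0, T] f ->
  leb.-integrable `[0, T] (majorant f).
Proof.
move=> T0 fi; have T00 : (0 : R) <= 0 <= T by rewrite lexx.
apply: integrableD => //; last exact: integrable_abse.
apply: integrableD => //; first exact: (integrable_abse (q_integrable gen T00)).
exact: (integrable_abse (alpha0_integrable gen T00)).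
Qed.

Let majorant_le (a b : R) (m : \bar R) : (0 <= m)%E ->
  (`|m| <= `|a%:E| + `|b%:E| + `|(a + b)%:E - m|)%E /\
  (`|(a + b)%:E - m| <= `|a%:E| + `|b%:E| + `|m|)%E.
Proof.
case: m => [m m0|_|//]; last by split; rewrite /= ?leey.
rewrite /= !lee_fin; split; rewrite ler_norml; apply/andP; split.
- by have := normr_ge0 a; have := normr_ge0 b; have := ler_norm (- m);
  have := ler_norm (a + b - m); have := ler_norm (- a); have := ler_norm (- b);
    have := ler_norm (-(a + b - m)); rewrite !normrN; lra.
- by have := ler_norm a; have := ler_norm b; have := ler_norm (- (a + b - m));
  rewrite normrN; lra.
- by have := ler_norm (- a); have := ler_norm (- b); have := ler_norm m;
  rewrite !normrN; lra.
- by have := ler_norm a; have := ler_norm b; have := ler_norm (- m); rewrite normrN; lra.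
Qed.

Lemma L1loc_dphi1 : L1loc (fun t => dphi1 t) <-> L1loc (excess alpha).
Proof.
have FF := ae_filter_ringOfSetsType leb.
split=> h T T0; have hT := h T T0; have iK := majorant_integrable T0 hT.
  have lK : (\int[leb]_(r in `[0%R, T]) majorant (fun t =>
    dphi1 t) r < +oo)%E by exact: integrable_lty.
  have mK := measurable_int _ iK.
  apply/integrableP; split; first exact: (measurable_excess gen).
  apply: le_lt_trans lK; apply: ae_ge0_le_integral => //.
  - by apply: measurableT_comp => //; exact: (measurable_excess gen).
  - by move=> r _; rewrite /majorant !adde_ge0.
  - have := ae_rate_cvg; apply: filterS => r cr /in0 r0.
    rewrite /majorant dphi1E//; last exact: cr.
    by have [] := majorant_le (q r) (alpha r 0%N) (excess_ge0 gen r0).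
have mK := measurable_int _ iK.
have lK : (\int[leb]_(r in `[0%R, T]) majorant (excess alpha) r < +oo)%E
  by exact: integrable_lty.
apply/integrableP; split; first exact: measurable_dphi1.
apply: le_lt_trans lK; apply: ae_ge0_le_integral => //.
- by apply: measurableT_comp => //; exact: measurable_dphi1.
- by move=> r _; rewrite /majorant !adde_ge0.
- have := ae_rate_cvg; apply: filterS => r cr /in0 r0.
  rewrite /majorant dphi1E//; last exact: cr.
  by have [] := majorant_le (q r) (alpha r 0%N) (excess_ge0 gen r0).
Qed.

Lemma integral_dphi1 (s t : R) : 0 <= s <= t ->
  {ae leb, forall t, 0 <= t -> q t = 0} -> L1loc (excess alpha) ->
  fine (\int[leb]_(r in `[s, t]) dphi1 r)%E =
  \int[leb]_(r in `[s, t]) alpha r 0%N - fine (\int[leb]_(r in `[s, t]) excess alpha r)%E.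
Proof.
move=> /[dup] st /andP[s0 st'] q0 iex; have t0 := le_trans s0 st'.
have FF := ae_filter_ringOfSetsType leb.
have sub : `[s, t] `<=` `[0, t] by apply: subset_itvr; rewrite bnd_simp.
have ie : leb.-integrable `[s, t] (excess alpha) by apply: integrableS (iex t t0).
have ia := alpha0_integrable gen st.
have -> : (\int[leb]_(r in `[s, t]) dphi1 r = \int[leb]_(r in `[s,
  t]) ((alpha r 0%N)%:E - excess alpha r))%E.
  apply: ae_eq_integral => //.
  - by apply: measurable_funS (measurable_dphi1 t0) => //.
  - apply: emeasurable_funB; last exact: (measurable_excess gen).
    by apply/measurable_EFinP; exact: (measurable_alpha gen).
  have := ae_rate_cvg; move: q0; apply: filterS2 => r qr cr /sub/in0 r0.
  by rewrite dphi1E// ?qr ?add0r//; exact: cr.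
rewrite integralB// fineB//; exact: integrable_fin_num.
Qed.

End boundary_rates.

(** * The equivalences and the formula for the mean *)

Unset Implicit Arguments.

Theorem mainTheorem18 (R : realType) (d : measure_display) (Omega : measurableType d)
  (P : R -> N0s -> probability Omega R) (N : R -> Omega -> N0s)
  (ell : R -> R -> N0s -> N0s -> R) (q : R -> R) (alpha : R -> nat -> R) :
  branching_process P N ell ->
  abs_cont_rev_evol_family (pgfs ell) ->
  generating_family q alpha ->
  associated_vector_field (pgfs ell) (herglotz q alpha) ->
  [<-> (forall (n : nat) (s t : R), (0 < n)%N -> 0 <= s <= t ->
          (expect P N s (Some n) t < +oo)%E);
       (forall t : R, 0 <= t -> (expect P N 0 (Some 1%N) t < +oo)%E);
       (forall t : R, 0 <= t ->
          at1 (on_reals (pgfs ell 0 t)) = 1%:E /\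
          (at1 (derive1 (on_reals (pgfs ell 0 t))) < +oo)%E);
       (forall s t : R, 0 <= s <= t ->
          at1 (on_reals (pgfs ell s t)) = 1%:E /\
          (at1 (derive1 (on_reals (pgfs ell s t))) < +oo)%E);
       {ae @lebesgue_measure R, forall t, 0 <= t ->
          at1 (on_reals (herglotz q alpha ^~ t)) = 0%:E} /\
       L1loc (fun t => at1 (derive1 (on_reals (herglotz q alpha ^~ t))));
       {ae @lebesgue_measure R, forall t, 0 <= t -> q t = 0} /\
       L1loc (fun t => (\sum_(n <oo | n != 1%N) ((n.+1)%:R * alpha t n)%:E)%E)]
  /\
  ((forall (n : nat) (s t : R), (0 < n)%N -> 0 <= s <= t ->
      (expect P N s (Some n) t < +oo)%E) ->
   forall (n : nat) (s t : R), (0 < n)%N -> 0 <= s <= t ->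
     expect P N s (Some n) t
       = ((n%:R)%:E * at1 (derive1 (on_reals (pgfs ell s t))))%E /\
     expect P N s (Some n) t
       = (n%:R * expR (- fine (\int[@lebesgue_measure R]_(r in `[s, t])
              at1 (derive1 (on_reals (herglotz q alpha ^~ r))))%E))%:E).
Proof.
move=> bp fam gen avf.
have bk : branching_kernels ell by case: bp.
have pr s t : 0 <= s <= t -> is_prob (ell s t (Some 1%N)) by exact: is_prob_ell.
have expectM s t n : 0 <= s <= t -> expect P N s (Some n) t = N0s_mean (ell s t (Some n)).
  by move=> st; rewrite (expectE bp).
have finP s t : 0 <= s <= t -> (expect P N s (Some 1%N) t < +oo)%E <->
    at1 (on_reals (pgfs ell s t)) = 1%:E /\ (at1 (derive1 (on_reals (pgfs ell s t))) <
      +oo)%E.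
  by move=> st; rewrite expectM// /pgfs on_reals_pgf; exact: N0s_mean_lty (pr _ _ st).
have expectZ s t n : 0 <= s <= t -> (expect P N s (Some 1%N) t < +oo)%E ->
    expect P N s (Some n) t = (n%:R%:E * expect P N s (Some 1%N) t)%E.
  move=> st; rewrite !expectM// => m1.
  have [e1 mE] := N0s_mean_fin (pr _ _ st) m1.
  have [en nE] := transition_mean bp n st e1.
  by rewrite mE -nE /N0s_mean en mul0e add0e.
(* Means from time 0 alone determine the behaviour of the rates, and the rates control the means
   from every s. Passing through the rates is how (3) yields (4). *)
have c36 : (forall t : R, 0 <= t -> (expect P N 0 (Some 1%N) t < +oo)%E) ->
    {ae @lebesgue_measure R, forall t, 0 <= t -> q t = 0} /\ L1loc (excess alpha).
  move=> h.
  have lr t : 0 <= t -> {ae @lebesgue_measure R, forall r, r \in `[0, t] -> q r = 0} /\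
      (@lebesgue_measure R).-integrable `[0, t] (excess alpha).
    move=> t0; apply: (limit_rates bk fam gen avf) => //.
    by rewrite -expectM ?h// lexx.
  split; last by move=> T T0; have [] := lr T T0.
  have : {ae @lebesgue_measure R, forall t, forall n : nat, t \in `[0, n%:R] -> q t = 0}.
    by apply/ae_foralln => n; have [] := lr n%:R (ler0n _ _).
  apply: filterS; first exact: (ae_filter_ringOfSetsType lebesgue_measure).
  by move=> t ht t0; apply: (ht (Num.bound t)); rewrite in_itv/= t0 ltW// archi_boundP.
have c61 : {ae @lebesgue_measure R, forall t, 0 <= t -> q t = 0} ->
  L1loc (excess alpha) ->
    forall s t, 0 <= s <= t -> (expect P N s (Some 1%N) t < +oo)%E.
  by move=> q0 iex s t st; rewrite expectM//; apply: (mean_lty bk fam gen avf q0 iex).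
have t00 (t : R) : 0 <= t -> (0 : R) <= 0 <= t by rewrite lexx.
have h1 : (forall (n : nat) (s t : R), (0 < n)%N -> 0 <= s <= t ->
  (expect P N s (Some n) t < +oo)%E) ->
    forall t : R, 0 <= t -> (expect P N 0 (Some 1%N) t < +oo)%E.
  by move=> h t /t00 t0; exact: h.
have h3 : (forall t : R, 0 <= t -> at1 (on_reals (pgfs ell 0 t)) = 1%:E /\
      (at1 (derive1 (on_reals (pgfs ell 0 t))) < +oo)%E) ->
    forall t : R, 0 <= t -> (expect P N 0 (Some 1%N) t < +oo)%E.
  by move=> h t t0; apply/finP; [exact: t00|exact: h].
split.
  tfae.
  - exact: h1.
  - by move=> h t t0; apply/finP; [exact: t00|exact: h].
  - by move=> /h3/c36[q0 iex] s t st; apply/finP => //; exact: c61.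
  - move=> h; have [|q0 iex] := c36 _; first by apply: h3 => t /t00; exact: h.
    by split; [apply/(ae_phi1_eq0 gen)|apply/(L1loc_dphi1 gen)].
  - by move=> [/(ae_phi1_eq0 gen) q0 /(L1loc_dphi1 gen) iex]; split => //;
    apply/(L1loc_weighted gen).
  - move=> [q0 /(L1loc_weighted gen) iex] n s t n0 st.
    have m1 := c61 q0 iex s t st; rewrite expectZ//.
    by rewrite lte_mul_pinfty// lee_fin.
move=> /h1/c36[q0 iex] n s t n0 st.
have m1 := c61 q0 iex s t st.
rewrite expectZ//; split.
  congr (_ * _)%E; move: m1; rewrite expectM// => m1.
  have [_ ->] := N0s_mean_fin (pr _ _ st) m1.
  by rewrite /pgfs on_reals_pgf (at1_derive_gf (pr _ _ st)).
rewrite expectM// (mean_expR bk fam gen avf q0 iex st) -EFinM.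
by rewrite (integral_dphi1 gen st q0 iex) opprB.
Qed.
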